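(* Let $\Lambda$, $(m_i,n_i,\mathcal{I}_i,N_i,B_i,C_i)_{i\in\Lambda}$, $(p_i)_{i\in\Lambda}$, $\mathbb{P}$ and $F_\omega$ be as in the context. Then for $\mathbb{P}$-almost every $\omega\in\Omega$, for every $\theta\in(0,1)$, \[ \dim_{\mathrm{A}}^\theta F_\omega=\begin{cases} \dfrac{1}{1-\theta}\left(\dfrac{\sum_{i\in\Lambda}p_i\log\left(B_iC_i^{\theta}N_i^{-\theta}\right)}{\sum_{i\in\Lambda}p_i\log m_i}+\dfrac{\sum_{i\in\Lambda}p_i\log\left(N_iB_i^{-1}C_i^{-\theta}\right)}{\sum_{i\in\Lambda}p_i\log n_i}\right), & 0<\theta\le \dfrac{\sum_{i}p_i\log m_i}{\sum_i p_i\log n_i},\\[3ex] \dfrac{\sum_{i}p_i\log B_i}{\sum_i p_i\log m_i}+\dfrac{\sum_i p_i\log C_i}{\sum_i p_i\log n_i}, & \dfrac{\sum_{i}p_i\log m_i}{\sum_i p_i\log n_i}<\theta<1. \end{cases} \]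
   Context: Let $\Lambda=\{1,\dots,|\Lambda|\}$ be a finite index set. For each $i\in\Lambda$ fix integers $n_i>m_i\ge 2$ and divide $[0,1]^2$ into the uniform grid of $m_i$ columns and $n_i$ rows, i.e. into $m_in_i$ closed rectangles of width $1/m_i$ and height $1/n_i$. Let $\mathcal{I}_i$ be a non-empty subset of these rectangles, $N_i=|\mathcal{I}_i|$, $B_i$ the number of distinct columns containing at least one rectangle of $\mathcal{I}_i$, and $C_i$ the maximum number of rectangles of $\mathcal{I}_i$ contained in a single column. For $j\in\mathcal{I}_i$ let $S_j$ be the unique orientation-preserving affine map (of the form $(x,y)\mapsto(x/m_i+a,\,y/n_i+b)$) mapping $[0,1]^2$ onto the rectangle $j$. Let $\Omega=\Lambda^{\mathbb{N}}$ and for $\omega=(\omega_1,\omega_2,\dots)\in\Omega$ let \[F_\omega=\bigcap_{k\ge1}\ \bigcup_{j_1\in\mathcal{I}_{\omega_1},\dots,j_k\in\mathcal{I}_{\omega_k}} S_{j_1}\circ\cdots\circ S_{j_k}([0,1]^2).\] Let $p_i\in(0,1)$ with $\sum_{i\in\Lambda}p_i=1$ and $\mathbb{P}=\prod_{k\in\mathbb{N}}\sum_{i\in\Lambda}p_i\delta_i$ the Bernoulli product measure on $\Omega$ (product topology). For bounded $E\subseteq\mathbb{R}^d$ and $r>0$, $N(E,r)$ denotes the minimal number of sets of diameter at most $r$ needed to cover $E$. For compact non-empty $F\subseteq\mathbb{R}^d$ and $\theta\in(0,1)$, the Assouad spectrum is \[\dim_{\mathrm{A}}^\theta F=\inf\Big\{\alpha:\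 \exists C>0\ \forall 0<R<1\ \forall x\in F,\ N\big(B(x,R)\cap F,R^{1/\theta}\big)\le C\big(R/R^{1/\theta}\big)^{\alpha}\Big\}.\] *)

(* Defs.v *)
From Stdlib Require Import Reals List Arith.
Import ListNotations.
Open Scope R_scope.

Definition pt := (R * R)%type.
Definition dist2 (x y : pt) : R :=
  sqrt ((fst x - fst y) ^ 2 + (snd x - snd y) ^ 2).

Definition sumL (L : nat) (f : nat -> R) : R :=
  fold_right Rplus 0 (map f (List.seq 0 L)).

(** Digit data: for index i, the chosen rectangle in column a (0 <= a < m i)
    and row b (0 <= b < n i) is in I_i iff D i a b = true.
    (Values of D with a >= m i or b >= n i are never used.) *)
Definition colcount (n : nat -> nat) (D : nat -> nat -> nat -> bool) (i a : nat) : nat :=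
  length (filter (D i a) (List.seq 0 (n i))).
Definition Ncount (m n : nat -> nat) D (i : nat) : nat :=
  fold_right Nat.add 0%nat (map (colcount n D i) (List.seq 0 (m i))).
Definition Bcount (m n : nat -> nat) D (i : nat) : nat :=
  length (filter (fun a => Nat.ltb 0 (colcount n D i a)) (List.seq 0 (m i))).
Definition Ccount (m n : nat -> nat) D (i : nat) : nat :=
  fold_right Nat.max 0%nat (map (colcount n D i) (List.seq 0 (m i))).

Definition Smap (m n : nat -> nat) (i a b : nat) (z : pt) : pt :=
  ((fst z + INR a) / INR (m i), (snd z + INR b) / INR (n i)).

(** iter_map ... t r z = S_{j_t} o S_{j_{t+1}} o ... o S_{j_{t+r-1}} (z),
    where j_s = (a s, b s) is a rectangle of I_{omega s}.
    Sequences omega : nat -> nat are indexed from 0 (omega 0 = omega_1). *)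
Fixpoint iter_map (m n : nat -> nat) (w a b : nat -> nat) (t r : nat) (z : pt) : pt :=
  match r with
  | O => z
  | S r' => Smap m n (w t) (a t) (b t) (iter_map m n w a b (S t) r' z)
  end.

Definition unit_square (z : pt) : Prop :=
  0 <= fst z <= 1 /\ 0 <= snd z <= 1.

Definition Fomega (m n : nat -> nat) (D : nat -> nat -> nat -> bool)
    (w : nat -> nat) (x : pt) : Prop :=
  forall k : nat, (1 <= k)%nat ->
    exists a b : nat -> nat,
      (forall t, (t < k)%nat ->
          (a t < m (w t))%nat /\ (b t < n (w t))%nat /\ D (w t) (a t) (b t) = true) /\
      exists z, unit_square z /\ x = iter_map m n w a b 0 k z.

(** "N(E, r) <= X": E can be covered by at most X sets of diameter <= r
    (since N(E,r) is a minimum, this is exactly N(E,r) <= X). *)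
Definition cover_le (E : pt -> Prop) (r X : R) : Prop :=
  exists (k : nat) (U : nat -> pt -> Prop),
    INR k <= X /\
    (forall j, (j < k)%nat -> forall y z, U j y -> U j z -> dist2 y z <= r) /\
    (forall y, E y -> exists j, (j < k)%nat /\ U j y).

Definition assouad_exps (F : pt -> Prop) (theta : R) (alpha : R) : Prop :=
  exists C, 0 < C /\
    forall Rr, 0 < Rr < 1 -> forall x, F x ->
      cover_le (fun y => F y /\ dist2 x y <= Rr) (Rpower Rr (1 / theta))
               (C * Rpower (Rr / Rpower Rr (1 / theta)) alpha).

Definition is_glb (S : R -> Prop) (v : R) : Prop :=
  (forall a, S a -> v <= a) /\ (forall w, (forall a, S a -> w <= a) -> w <= v).

Definition assouad_spectrum_eq (F : pt -> Prop) (theta v : R) : Prop :=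
  is_glb (assouad_exps F theta) v.

(** Bernoulli product measure on Omega = Lambda^N: outer measure zero sets.
    A word w (list of letters in Lambda) determines the cylinder [w]. *)
Definition valid_seq (L : nat) (w : nat -> nat) : Prop := forall t, (w t < L)%nat.
Definition in_cyl (u : list nat) (w : nat -> nat) : Prop :=
  forall t, (t < length u)%nat -> w t = nth t u 0%nat.
Definition cyl_weight (p : nat -> R) (u : list nat) : R :=
  fold_right Rmult 1 (map p u).

Definition Pnull (L : nat) (p : nat -> R) (E : (nat -> nat) -> Prop) : Prop :=
  forall eps, 0 < eps ->
    exists W : nat -> list nat,
      (forall k, Forall (fun i => (i < L)%nat) (W k)) /\
      (forall w, valid_seq L w -> E w -> exists k, in_cyl (W k) w) /\
      (forall K, sumL K (fun k => cyl_weight p (W k)) <= eps).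

Definition almost_every (L : nat) (p : nat -> R) (Q : (nat -> nat) -> Prop) : Prop :=
  Pnull L p (fun w => ~ Q w).

(* Main.v *)
Require Import Defs.
From Stdlib Require Import Reals List Arith.
From Stdlib Require Import Lia Lra Psatz Classical.
Import ListNotations.
Open Scope R_scope.

(** Write [R = exp (- s)] and [r = R ^ (1 / theta) = exp (- s / theta)].  Let [h1], [h2] be the
    numbers of steps after which the products of the widths [1 / m], respectively of the heights
    [1 / n], drop to scale [R], and [l1], [l2] the same for [r]; then [h2 <= h1], [l2 <= l1],
    [h1 <= l1], [h2 <= l2].  Up to bounded factors, [B(x, R)] is an approximate square of
    level [(h1, h2)] and [N (B(x, R), r)] counts the approximate squares of level [(l1, l2)] in it.
    At a position in [[h2, h1)] the column is already fixed, at a position in [[l2, l1)] only the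
    column matters, so the largest count is the product of [C] over [[h2, min h1 l2)], of [N] over
    [[h1, l2)] and of [B] over [[max h1 l2, l1)].  By the law of large numbers the logarithm of
    this product is linear in [s] up to a sublinear error, with the slope predicted by the formula;
    when the order of [h1] and [l2] differs from the one suggested by the position of [theta]
    relative to [Sm / Sn], the two candidate slopes agree up to that error.  The law of large
    numbers holds off a set covered by the words of length [k] whose deviation exceeds
    [4 sqrt k ln k], the total weight of which is [O (1 / k ^ 2)] by Chernoff's bound. *)

(** * Strong law of large numbers in terms of cylinders *)

Definition lsum {X : Type} (f : X -> R) (l : list X) : R :=
  fold_right Rplus 0 (map f l).

Lemma lsum_app {X} (f : X -> R) l1 l2 : lsum f (l1 ++ l2) = lsum f l1 + lsum f l2.
Proof.
  unfold lsum; induction l1 as [|x l1 IH]; simpl; [lra|].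
  rewrite IH; lra.
Qed.

Lemma lsum_map {X Y} (g : X -> Y) (f : Y -> R) l :
  lsum f (map g l) = lsum (fun x => f (g x)) l.
Proof. unfold lsum; now rewrite map_map. Qed.

Lemma lsum_flat_map {X Y} (g : X -> list Y) (f : Y -> R) l :
  lsum f (flat_map g l) = lsum (fun x => lsum f (g x)) l.
Proof.
  induction l as [|x l IH]; simpl; [reflexivity|].
  rewrite lsum_app, IH; reflexivity.
Qed.

Lemma lsum_ext_in {X} (f g : X -> R) l :
  (forall x, In x l -> f x = g x) -> lsum f l = lsum g l.
Proof. intros H; unfold lsum; f_equal; now apply map_ext_in. Qed.

Lemma lsum_plus {X} (f g : X -> R) l : lsum (fun x => f x + g x) l = lsum f l + lsum g l.
Proof. unfold lsum; induction l as [|x l IH]; simpl; [lra|]. rewrite IH; lra. Qed.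

Lemma lsum_scal {X} c (f : X -> R) l : lsum (fun x => c * f x) l = c * lsum f l.
Proof. unfold lsum; induction l as [|x l IH]; simpl; [lra|]. rewrite IH; lra. Qed.

Lemma lsum_le {X} (f g : X -> R) l :
  (forall x, In x l -> f x <= g x) -> lsum f l <= lsum g l.
Proof.
  unfold lsum; induction l as [|x l IH]; simpl; intros H; [lra|].
  assert (f x <= g x) by auto. assert (IH' := IH (fun y Hy => H y (or_intror Hy))). lra.
Qed.

Lemma lsum_nonneg {X} (f : X -> R) l : (forall x, In x l -> 0 <= f x) -> 0 <= lsum f l.
Proof.
  unfold lsum; induction l as [|x l IH]; simpl; intros H; [lra|].
  assert (0 <= f x) by auto. assert (IH' := IH (fun y Hy => H y (or_intror Hy))). lra.
Qed.

(** The form in which Markov's inequality enters [chernoff]. *)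
Lemma lsum_filter {X} (P : X -> bool) (f g : X -> R) l :
  (forall x, In x l -> 0 <= g x) ->
  (forall x, In x l -> P x = true -> f x <= g x) ->
  lsum f (filter P l) <= lsum g l.
Proof.
  unfold lsum; induction l as [|x l IH]; simpl; intros H0 H; [lra|].
  assert (IH' := IH (fun y Hy => H0 y (or_intror Hy)) (fun y Hy => H y (or_intror Hy))).
  assert (0 <= g x) by auto.
  destruct (P x) eqn:E; simpl; [assert (f x <= g x) by auto|]; lra.
Qed.

Lemma sumL_S k f : sumL (S k) f = sumL k f + f k.
Proof.
  change (lsum f (List.seq 0 (S k)) = lsum f (List.seq 0 k) + f k).
  rewrite seq_S, lsum_app; unfold lsum; simpl; lra.
Qed.

Lemma sumL_ext k f g : (forall i, (i < k)%nat -> f i = g i) -> sumL k f = sumL k g.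
Proof. intros H; apply lsum_ext_in; intros i Hi; apply in_seq in Hi; apply H; lia. Qed.

Lemma sumL_plus k f g : sumL k (fun i => f i + g i) = sumL k f + sumL k g.
Proof. apply lsum_plus. Qed.

Lemma sumL_scal k c f : sumL k (fun i => c * f i) = c * sumL k f.
Proof. apply lsum_scal. Qed.

Lemma sumL_le k f g : (forall i, (i < k)%nat -> f i <= g i) -> sumL k f <= sumL k g.
Proof. intros H; apply lsum_le; intros i Hi; apply in_seq in Hi; apply H; lia. Qed.

Lemma sumL_const k c : sumL k (fun _ => c) = INR k * c.
Proof.
  induction k as [|k IH]; [unfold sumL; simpl; lra|].
  rewrite sumL_S, IH, S_INR; lra.
Qed.

Fixpoint words (L k : nat) : list (list nat) :=
  match k with
  | O => [[]]
  | S k' => flat_map (fun u => map (fun i => i :: u) (List.seq 0 L)) (words L k')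
  end.

Lemma in_words L u : Forall (fun i => (i < L)%nat) u -> In u (words L (length u)).
Proof.
  induction 1 as [|i u Hi Hu IH]; simpl; [now left|].
  apply in_flat_map; exists u; split; [exact IH|].
  apply in_map_iff; exists i; split; [reflexivity|]. apply in_seq; lia.
Qed.

Lemma words_valid L k u :
  In u (words L k) -> Forall (fun i => (i < L)%nat) u /\ length u = k.
Proof.
  revert u; induction k as [|k IH]; simpl; intros u H.
  - destruct H as [<-|[]]; now split.
  - apply in_flat_map in H; destruct H as (v & Hv & H).
    apply in_map_iff in H; destruct H as (i & <- & Hi); apply in_seq in Hi.
    destruct (IH v Hv) as [H1 H2]; simpl; split; [constructor; [lia|exact H1]|lia].
Qed.

(** Expanding the power of the sum yields one product per word. For [g i = p i * exp (t * f i)] this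
    is the moment generating function of a sum of [k] independent letters. *)
Lemma words_product L g k :
  lsum (fun u => fold_right Rmult 1 (map g u)) (words L k) = sumL L g ^ k.
Proof.
  induction k as [|k IH]; simpl; [unfold lsum; simpl; lra|].
  rewrite lsum_flat_map, <- IH, <- lsum_scal.
  apply lsum_ext_in; intros u _; rewrite lsum_map; simpl.
  change (sumL L g) with (lsum g (List.seq 0 L)).
  rewrite Rmult_comm, <- lsum_scal; apply lsum_ext_in; intros; ring.
Qed.

Lemma exp_weight_product p f t u :
  fold_right Rmult 1 (map (fun i => p i * exp (t * f i)) u) =
  cyl_weight p u * exp (t * lsum f u).
Proof.
  unfold cyl_weight, lsum; induction u as [|i u IH]; simpl.
  - rewrite Rmult_0_r, exp_0; lra.
  - rewrite IH, Rmult_plus_distr_l, exp_plus; ring.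
Qed.

Lemma cyl_weight_nonneg L p u :
  (forall i, (i < L)%nat -> 0 < p i < 1) -> Forall (fun i => (i < L)%nat) u ->
  0 <= cyl_weight p u.
Proof.
  intros Hp; induction 1 as [|i u Hi Hu IH]; unfold cyl_weight in *; simpl; [lra|].
  apply Rmult_le_pos; [apply Hp in Hi; lra|exact IH].
Qed.

(* From [exp (- x) >= 1 - x]: [exp x <= / (1 - x)], and
   [(1 + x + 2 x^2) (1 - x) = 1 + x^2 (1 - 2 x)]. *)
Lemma exp_le_quadratic x : x <= 1/2 -> exp x <= 1 + x + 2 * x ^ 2.
Proof.
  intros Hx.
  assert (H := exp_ineq1_le (- x)). assert (Hp := exp_pos x).
  assert (He : exp x * exp (- x) = 1) by (rewrite <- exp_plus, Rplus_opp_r; apply exp_0).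
  nra.
Qed.

Lemma exp_le_exp x y : x <= y -> exp x <= exp y.
Proof. intros [H| ->]; [left; now apply exp_increasing|lra]. Qed.

Lemma ln_le_ln x y : 0 < x -> x <= y -> ln x <= ln y.
Proof. intros Hx [H| ->]; [left; now apply ln_increasing|lra]. Qed.

Lemma exp_pow x k : exp x ^ k = exp (INR k * x).
Proof.
  induction k as [|k IH]; [simpl; rewrite Rmult_0_l, exp_0; reflexivity|].
  rewrite S_INR, <- tech_pow_Rmult, IH, <- exp_plus; f_equal; ring.
Qed.

(** Exponential Markov inequality: on the selected words [exp (t * (lsum f u - d)) >= 1]. Because
    [f] has mean zero, the quadratic bound on [exp] makes the moment generating function of one
    letter at most [1 + 2 t^2 <= exp (2 t^2)]. *)
Lemma chernoff L p f t d k :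
  (forall i, (i < L)%nat -> 0 < p i < 1) -> sumL L p = 1 ->
  (forall i, (i < L)%nat -> Rabs (f i) <= 1) -> sumL L (fun i => p i * f i) = 0 ->
  0 <= t <= 1/2 ->
  lsum (cyl_weight p) (filter (fun u => if Rlt_dec d (lsum f u) then true else false) (words L k))
  <= exp (2 * t ^ 2 * INR k - t * d).
Proof.
  intros Hp Hsum Hf Hmean Ht.
  eapply Rle_trans.
  - apply (lsum_filter _ _ (fun u => exp (- (t * d)) *
      fold_right Rmult 1 (map (fun i => p i * exp (t * f i)) u))).
    + intros u Hu; apply words_valid in Hu; rewrite exp_weight_product.
      apply Rmult_le_pos; [left; apply exp_pos|].
      apply Rmult_le_pos; [now apply (cyl_weight_nonneg L)|left; apply exp_pos].
    + intros u Hu; destruct (Rlt_dec d (lsum f u)) as [Hd|]; [intros _|discriminate].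
      rewrite exp_weight_product.
      apply words_valid in Hu; destruct Hu as [Hu _].
      assert (H0 := cyl_weight_nonneg L p u Hp Hu).
      replace (exp (- (t * d)) * (cyl_weight p u * exp (t * lsum f u)))
        with (cyl_weight p u * exp (t * (lsum f u - d))).
      2:{ replace (t * (lsum f u - d)) with (- (t * d) + t * lsum f u) by ring.
          rewrite exp_plus; ring. }
      assert (1 <= exp (t * (lsum f u - d))); [|nra].
      assert (H := exp_ineq1_le (t * (lsum f u - d))). nra.
  - rewrite lsum_scal, words_product.
    assert (Hg : 0 <= sumL L (fun i => p i * exp (t * f i)) <= exp (2 * t ^ 2)).
    { split.
      - apply lsum_nonneg; intros i Hi; apply in_seq in Hi.
        assert (0 < p i < 1) by (apply Hp; lia). assert (Hx := exp_pos (t * f i)). nra.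
      - apply Rle_trans with (sumL L (fun i => (p i + t * (p i * f i)) + 2 * t ^ 2 * p i)).
        + apply sumL_le; intros i Hi; specialize (Hp i Hi); specialize (Hf i Hi).
          assert (Hb : -1 <= f i <= 1) by (revert Hf; unfold Rabs; destruct Rcase_abs; lra).
          assert (Htf : t * f i <= 1 / 2) by nra.
          assert (Hx := exp_le_quadratic (t * f i) Htf).
          assert (Hsq : (t * f i) ^ 2 <= t ^ 2).
          { assert (0 <= t ^ 2 * (1 - f i) * (1 + f i)); [|lra].
            repeat apply Rmult_le_pos; lra. }
          apply (Rmult_le_compat_l (p i)) in Hx; nra.
        + rewrite !sumL_plus, !sumL_scal, Hsum, Hmean.
          assert (Hx := exp_ineq1_le (2 * t ^ 2)). lra. }
    apply Rle_trans with (exp (- (t * d)) * exp (2 * t ^ 2) ^ k).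
    + apply Rmult_le_compat_l; [left; apply exp_pos|]. now apply pow_incr.
    + right. rewrite exp_pow, <- exp_plus; f_equal; ring.
Qed.

(** The terms are compared with the telescoping differences [1/j - 1/(j+1)]. *)
Lemma inv_square_tail_sum K0 K : (2 <= K0)%nat ->
  sumL K (fun k => / INR (K0 + k) ^ 2) <= / INR (K0 - 1) - / INR (K0 + K - 1).
Proof.
  intros HK; induction K as [|K IH].
  - unfold sumL; simpl; rewrite Nat.add_0_r; lra.
  - rewrite sumL_S.
    replace (K0 + S K - 1)%nat with (S (K0 + K - 1)) by lia.
    set (j := (K0 + K - 1)%nat) in *. replace (K0 + K)%nat with (S j) by (unfold j; lia).
    assert (Hj : 1 <= INR j) by (apply (le_INR 1); unfold j; lia).
    rewrite S_INR.
    assert (/ (INR j + 1) ^ 2 <= / INR j - / (INR j + 1)); [|lra].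
    replace (/ INR j - / (INR j + 1)) with (/ (INR j * (INR j + 1))) by (field; lra).
    apply Rinv_le_contravar; nra.
Qed.

(** * The first Borel-Cantelli lemma for covers by cylinders *)

Section Enumerate.
Context {X : Type} (f : nat -> list X) (x0 : X).

Let prefix (k : nat) : list X := flat_map f (List.seq 0 k).
(** [Pnull] asks for one sequence of words, whereas the bad words come in finite blocks; the blocks
    are concatenated. Once all blocks are non-empty, the first [S i] of them hold more than [i]
    entries, so the default [x0] is never returned. *)
Definition enumerate_blocks (i : nat) : X := nth i (prefix (S i)) x0.

Lemma prefix_S k : prefix (S k) = prefix k ++ f k.
Proof. unfold prefix; rewrite seq_S, flat_map_app; simpl; now rewrite app_nil_r. Qed.

Lemma prefix_le j k : (j <= k)%nat -> exists l, prefix k = prefix j ++ l.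
Proof.
  induction 1 as [|k Hk [l IH]]; [exists []; now rewrite app_nil_r|].
  exists (l ++ f k). now rewrite prefix_S, IH, app_assoc.
Qed.

Hypothesis f_nonempty : forall k, f k <> [].

Lemma length_prefix k : (k <= length (prefix k))%nat.
Proof.
  induction k as [|k IH]; [simpl; lia|]. rewrite prefix_S, length_app.
  specialize (f_nonempty k); destruct (f k); [congruence|simpl; lia].
Qed.

Lemma enumerate_blocks_nth i k :
  (i < length (prefix k))%nat -> enumerate_blocks i = nth i (prefix k) x0.
Proof.
  intros H; unfold enumerate_blocks; assert (Hl := length_prefix (S i)).
  destruct (Nat.le_ge_cases k (S i)) as [Hk|Hk]; apply prefix_le in Hk; destruct Hk as [l Hk];
    rewrite Hk in *; rewrite app_nth1; auto; lia.
Qed.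

Lemma enumerate_blocks_in k x : In x (f k) -> exists i, enumerate_blocks i = x.
Proof.
  intros H. assert (Hx : In x (prefix (S k))) by (rewrite prefix_S; apply in_app_iff; now right).
  apply (In_nth _ _ x0) in Hx; destruct Hx as (i & Hi & <-).
  exists i; now apply enumerate_blocks_nth.
Qed.

Lemma enumerate_blocks_block i : exists k, In (enumerate_blocks i) (f k).
Proof.
  assert (H : In (enumerate_blocks i) (prefix (S i))).
  { apply nth_In; apply length_prefix. }
  apply in_flat_map in H; destruct H as (k & _ & H); now exists k.
Qed.

(** The first [K] entries all lie in the first [K] blocks, and the remaining entries of these blocks
    have non-negative cost. *)
Lemma enumerate_blocks_sum (c : X -> R) K :
  (forall k x, In x (f k) -> 0 <= c x) ->
  sumL K (fun i => c (enumerate_blocks i)) <= sumL K (fun k => lsum c (f k)).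
Proof.
  intros Hc.
  replace (sumL K (fun k => lsum c (f k))) with (lsum c (prefix K)).
  2:{ unfold prefix; rewrite lsum_flat_map; reflexivity. }
  assert (Hl := length_prefix K).
  rewrite <- (firstn_skipn K (prefix K)), lsum_app.
  assert (0 <= lsum c (skipn K (prefix K))).
  { apply lsum_nonneg; intros x Hx.
    assert (H : In x (prefix K)).
    { rewrite <- (firstn_skipn K (prefix K)); apply in_app_iff; now right. }
    apply in_flat_map in H; destruct H as (k & _ & H); now apply (Hc k). }
  assert (E : forall j, (j <= K)%nat ->
    sumL j (fun i => c (enumerate_blocks i)) = lsum c (firstn j (prefix K))); [|rewrite E; lra || lia].
  induction j as [|j IH]; intros Hj; [reflexivity|].
  rewrite sumL_S, IH by lia.
  rewrite (enumerate_blocks_nth j K) by lia.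
  assert (Hj' : (j < length (prefix K))%nat) by lia. revert Hj'.
  clear; generalize (prefix K) as l; revert j.
  intros j l; revert j; induction l as [|x l IH]; simpl; intros j Hj; [lia|].
  destruct j as [|j]; unfold lsum in *; simpl in *; [lra|].
  specialize (IH j ltac:(lia)); destruct l; simpl in *; lra.
Qed.

End Enumerate.

(** Every tail of the sequence of blocks covers [E], and the tail from [K0] on weighs at most
    [c / (K0 - 1)]. *)
Lemma borel_cantelli L p (block : nat -> list (list nat)) c (E : (nat -> nat) -> Prop) :
  (forall i, (i < L)%nat -> 0 < p i < 1) ->
  (forall k u, In u (block k) -> Forall (fun i => (i < L)%nat) u) ->
  (forall k, block k <> []) ->
  (forall k, (1 <= k)%nat -> lsum (cyl_weight p) (block k) <= c * / INR k ^ 2) ->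
  (forall w, valid_seq L w -> E w ->
     forall K, exists k u, (K <= k)%nat /\ In u (block k) /\ in_cyl u w) ->
  Pnull L p E.
Proof.
  intros Hp Hv Hne Hc HE eps Heps.
  assert (Hc0 : 0 <= c).
  { specialize (Hc 1%nat (le_n _)). simpl in Hc.
    assert (0 <= lsum (cyl_weight p) (block 1%nat)); [|lra].
    apply lsum_nonneg; intros u Hu; apply (cyl_weight_nonneg L); eauto. }
  destruct (INR_unbounded (c / eps + 1)) as [K1 HK1].
  (* This gives [K0 - 1 > c / eps], and [K0 >= 2] as the telescoping bound requires. *)
  set (K0 := (K1 + 2)%nat).
  set (f := fun k => block (K0 + k)%nat).
  assert (Hnf : forall k, f k <> []) by (intros; apply Hne).
  exists (enumerate_blocks f []); split; [|split].
  - intros k; destruct (enumerate_blocks_block f [] Hnf k) as [j Hj]; eapply Hv; exact Hj.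
  - intros w Hw HEw; destruct (HE w Hw HEw K0) as (k & u & Hk & Hu & Hcyl).
    destruct (enumerate_blocks_in f [] Hnf (k - K0) u) as [i <-].
    + unfold f; now replace (K0 + (k - K0))%nat with k by lia.
    + now exists i.
  - intros K; eapply Rle_trans.
    + apply enumerate_blocks_sum; [exact Hnf|].
      intros k u Hu; apply (cyl_weight_nonneg L); [exact Hp|]; eapply Hv; exact Hu.
    + apply Rle_trans with (sumL K (fun k => c * / INR (K0 + k) ^ 2)).
      * apply sumL_le; intros k _; apply Hc; unfold K0; lia.
      * rewrite sumL_scal.
        assert (H := inv_square_tail_sum K0 K ltac:(unfold K0; lia)).
        assert (H1 : 0 < / INR (K0 + K - 1)) by (apply Rinv_0_lt_compat, lt_0_INR; unfold K0; lia).
        assert (Hd : 0 <= c / eps) by (apply Rmult_le_pos; [lra|left; now apply Rinv_0_lt_compat]).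
        assert (H2 : INR K1 <= INR (K0 - 1)) by (apply le_INR; unfold K0; lia).
        apply Rle_trans with (c * / INR (K0 - 1)); [apply Rmult_le_compat_l; lra|].
        apply Rmult_le_reg_r with (INR (K0 - 1)); [lra|].
        rewrite Rmult_assoc, Rinv_l, Rmult_1_r by lra.
        assert (c = eps * (c / eps)) by (field; lra). nra.
Qed.

(** Two covers of weight at most [eps / 2] are interleaved at the even and the odd indices. *)
Lemma almost_every_and L p (Q1 Q2 : (nat -> nat) -> Prop) :
  almost_every L p Q1 -> almost_every L p Q2 -> almost_every L p (fun w => Q1 w /\ Q2 w).
Proof.
  intros H1 H2 eps Heps.
  destruct (H1 (eps / 2) ltac:(lra)) as (W1 & HV1 & HC1 & HS1).
  destruct (H2 (eps / 2) ltac:(lra)) as (W2 & HV2 & HC2 & HS2).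
  set (W := fun k => if Nat.even k then W1 (Nat.div2 k) else W2 (Nat.div2 k)).
  exists W; split; [|split].
  - intros k; unfold W; destruct (Nat.even k); auto.
  - intros w Hw HQ; apply not_and_or in HQ; destruct HQ as [HQ|HQ].
    + destruct (HC1 w Hw HQ) as [k Hk]; exists (2 * k)%nat; unfold W.
      now rewrite Nat.even_even, Nat.div2_double.
    + destruct (HC2 w Hw HQ) as [k Hk]; exists (S (2 * k)); unfold W.
      now rewrite <- Nat.add_1_r, Nat.even_odd, Nat.add_1_r, Nat.div2_succ_double.
  - assert (HD : forall K, sumL (2 * K) (fun k => cyl_weight p (W k)) =
       sumL K (fun k => cyl_weight p (W1 k)) + sumL K (fun k => cyl_weight p (W2 k))).
    { induction K as [|K IH]; [unfold sumL; simpl; lra|].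
      replace (2 * S K)%nat with (S (S (2 * K))) by lia.
      rewrite !sumL_S, IH; unfold W.
      rewrite Nat.even_even, Nat.div2_double, Nat.div2_succ_double.
      rewrite <- (Nat.add_1_r (2 * K)), Nat.even_odd; lra. }
    intros K.
    destruct (Nat.Even_or_Odd K) as [[j ->]|[j ->]].
    + rewrite HD; specialize (HS1 j); specialize (HS2 j); lra.
    (* With an odd number of terms the even-indexed cover is one term ahead. *)
    + rewrite Nat.add_1_r, sumL_S, HD; unfold W at 1.
      rewrite Nat.even_even, Nat.div2_double.
      specialize (HS1 (S j)); specialize (HS2 j); rewrite sumL_S in HS1; lra.
Qed.

Lemma almost_every_impl L p (Q1 Q2 : (nat -> nat) -> Prop) :
  (forall w, valid_seq L w -> Q1 w -> Q2 w) -> almost_every L p Q1 -> almost_every L p Q2.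
Proof.
  intros H H1 eps Heps; destruct (H1 eps Heps) as (W & HV & HC & HS).
  exists W; split; [exact HV|split; [|exact HS]].
  intros w Hw HQ; apply HC; [exact Hw|]; intros HQ1; auto.
Qed.

(** With [k = y^2] the left side is [8 y ln y]. The bound [ln (d y) <= d y - 1] leaves
    [8 d y^2 + 8 a y], and completing the square absorbs [8 a y] into another [8 d y^2] and a
    constant; hence [d = eps / 16]. *)
Lemma sqrt_ln_sublinear eps : 0 < eps ->
  exists c, forall k, (1 <= k)%nat -> 4 * sqrt (INR k) * ln (INR k) <= eps * INR k + c.
Proof.
  intros Heps. set (d := eps / 16). assert (Hd : 0 < d) by (unfold d; lra).
  set (a := -1 - ln d). exists (2 * a ^ 2 / d); intros k Hk.
  assert (Hk0 : 0 < INR k) by (apply lt_0_INR; lia).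
  set (y := sqrt (INR k)). assert (Hy : 0 < y) by now apply sqrt_lt_R0.
  assert (Hy2 : INR k = y * y) by (symmetry; apply sqrt_sqrt; lra).
  rewrite Hy2, ln_mult by assumption.
  assert (Hl : ln y <= d * y + a).
  { assert (H := exp_ineq1_le (ln (d * y))). rewrite exp_ln, ln_mult in H by nra. unfold a; lra. }
  assert (Ha : 8 * y * a <= 8 * d * (y * y) + 2 * a ^ 2 / d).
  { assert (H : 0 <= 8 * d * (y - a / (2 * d)) ^ 2) by (apply Rmult_le_pos; [lra|apply pow2_ge_0]).
    replace (8 * d * (y - a / (2 * d)) ^ 2) with (8 * d * (y * y) - 8 * y * a + 2 * a ^ 2 / d) in H
      by (field; lra). lra. }
  assert (8 * y * ln y <= 8 * y * (d * y + a)) by (apply Rmult_le_compat_l; lra).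
  replace eps with (16 * d) by (unfold d; lra). nra.
Qed.

(** Here [q^k = 1 / exp (l k / 2)^2] for [l = - ln q], and [exp x >= x]. The bound serves for the
    weight of the padding word in [slln_upper_normalized]. *)
Lemma pow_le_inv_square q : 0 < q < 1 ->
  exists c, forall k, (1 <= k)%nat -> q ^ k <= c * / INR k ^ 2.
Proof.
  intros Hq. set (l := - ln q).
  assert (Hl : 0 < l) by (unfold l; rewrite <- ln_1; assert (ln q < ln 1) by (apply ln_increasing; lra);
                          rewrite ln_1 in *; lra).
  exists (4 / l ^ 2); intros k Hk.
  assert (Hk0 : 0 < INR k) by (apply lt_0_INR; lia).
  rewrite <- (exp_ln q) at 1 by lra.
  replace (exp (ln q) ^ k) with (/ exp (l * INR k / 2) ^ 2).
  - replace (4 / l ^ 2 * / INR k ^ 2) with (/ (l * INR k / 2) ^ 2) by (field; lra).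
    assert (0 < l * INR k) by nra.
    apply Rinv_le_contravar; [apply pow_lt; lra|].
    apply pow_incr; split; [lra|]. assert (H1 := exp_ineq1_le (l * INR k / 2)); lra.
  - rewrite !exp_pow, <- exp_Ropp; f_equal; unfold l; simpl; field.
Qed.

(** Outside the Borel-Cantelli null set only finitely many prefixes are bad. Good prefixes have
    deviation at most [4 sqrt k ln k], which is sublinear; the others are absorbed by the
    constant. *)
Lemma slln_upper_normalized L p f :
  (1 <= L)%nat -> (forall i, (i < L)%nat -> 0 < p i < 1) -> sumL L p = 1 ->
  (forall i, (i < L)%nat -> Rabs (f i) <= 1) -> sumL L (fun i => p i * f i) = 0 ->
  almost_every L p (fun w => forall eps, 0 < eps ->
    exists c, forall k, sumL k (fun t => f (w t)) <= eps * INR k + c).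
Proof.
  intros HL Hp Hsum Hf Hmean.
  set (bad := fun k => filter
    (fun u => if Rlt_dec (4 * sqrt (INR k) * ln (INR k)) (lsum f u) then true else false) (words L k)).
  destruct (pow_le_inv_square (p 0%nat) (Hp 0%nat HL)) as [c0 Hc0].
  (* The word [0^k] is added to keep each block non-empty; its weight [p 0 ^ k] is summable as
     well. *)
  apply (borel_cantelli L p (fun k => repeat 0%nat k :: bad k) (c0 + exp (1/2))).
  - exact Hp.
  - intros k u [<-|Hu].
    + apply Forall_forall; intros x Hx; apply repeat_spec in Hx; subst; lia.
    + apply filter_In in Hu; destruct Hu as [Hu _]; now apply words_valid in Hu.
  - discriminate.
  - intros k Hk.
    assert (Hk0 : 0 < INR k) by (apply lt_0_INR; lia).
    assert (Hk1 : 1 <= INR k) by (apply (le_INR 1); lia).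
    set (y := sqrt (INR k)).
    assert (Hy1 : 1 <= y) by (rewrite <- sqrt_1; apply sqrt_le_1; lra).
    assert (Hy2 : y * y = INR k) by (apply sqrt_sqrt; lra).
    assert (Hcyl : cyl_weight p (repeat 0%nat k) = p 0%nat ^ k).
    { unfold cyl_weight; clear; induction k as [|k IH]; simpl; [reflexivity|now rewrite IH]. }
    assert (Hch : lsum (cyl_weight p) (bad k) <= exp (1/2) * / INR k ^ 2).
    { eapply Rle_trans.
      (* The choice [t = 1 / (2 sqrt k)] turns the exponent into [1/2 - 2 ln k]. *)
      - apply (chernoff L p f (/ (2 * y)) _ k Hp Hsum Hf Hmean).
        split; [left; apply Rinv_0_lt_compat; lra|].
        apply Rmult_le_reg_r with (2 * y); [lra|]. rewrite Rinv_l by lra. lra.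
      - right. fold y. rewrite <- Hy2 at 1.
        replace (2 * (/ (2 * y)) ^ 2 * (y * y) - / (2 * y) * (4 * y * ln (INR k)))
          with (1/2 + - (ln (INR k) + ln (INR k))) by (field; lra).
        rewrite exp_plus, exp_Ropp, exp_plus, exp_ln by lra. f_equal; f_equal; ring. }
    specialize (Hc0 k Hk). unfold lsum in *; simpl; rewrite Hcyl. simpl in *. lra.
  - intros w Hw HQ K. apply NNPP; intros HK; apply HQ; intros eps Heps.
    destruct (sqrt_ln_sublinear eps Heps) as [c Hc].
    assert (Hgood : forall k, (1 <= k)%nat -> (K <= k)%nat ->
      sumL k (fun t => f (w t)) <= 4 * sqrt (INR k) * ln (INR k)).
    { intros k Hk1 Hk. apply Rnot_lt_le; intros Hlt; apply HK.
      exists k, (map w (List.seq 0 k)); split; [exact Hk|split].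
      - right; apply filter_In; split.
        + assert (Hlen : length (map w (List.seq 0 k)) = k) by (now rewrite length_map, length_seq).
          rewrite <- Hlen at 2; apply in_words, Forall_forall.
          intros x Hx; apply in_map_iff in Hx; destruct Hx as (t & <- & _); apply Hw.
        + destruct (Rlt_dec _ _) as [|Hn]; [reflexivity|]; exfalso; apply Hn.
          rewrite lsum_map; exact Hlt.
      - intros t Ht. rewrite length_map, length_seq in Ht.
        rewrite (nth_indep _ _ (w 0%nat)) by (now rewrite length_map, length_seq).
        now rewrite map_nth, seq_nth. }
    (* For [k <= K] the sum is at most [k <= K] because the values of [f] are at most 1. *)
    exists (INR K + Rabs c + 1); intros k.
    assert (Hc' := Rle_abs c). assert (Habs := Rabs_pos c).
    assert (Hk0 := pos_INR k). assert (HK0 := pos_INR K).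
    destruct (Nat.le_gt_cases k K) as [HkK|HkK].
    + assert (sumL k (fun t => f (w t)) <= INR k).
      { rewrite <- (Rmult_1_r (INR k)), <- sumL_const; apply sumL_le; intros t _.
        eapply Rle_trans; [apply Rle_abs|apply Hf, Hw]. }
      apply le_INR in HkK. nra.
    + specialize (Hgood k ltac:(lia) ltac:(lia)); specialize (Hc k ltac:(lia)). lra.
Qed.

Lemma finite_bound k (f : nat -> R) : exists H, 0 < H /\ forall i, (i < k)%nat -> Rabs (f i) <= H.
Proof.
  induction k as [|k (H & H0 & IH)]; [exists 1; split; [lra|intros; lia]|].
  assert (Hk := Rabs_pos (f k)).
  exists (H + Rabs (f k)); split; [lra|]; intros i Hi.
  destruct (Nat.eq_dec i k) as [->|]; [lra|]. specialize (IH i ltac:(lia)); lra.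
Qed.

(** Convergence of the averages to [mu], written without limits: the constant [c] absorbs small [k],
    so the estimate can be used at any level at once. *)
Definition has_mean (w : nat -> nat) (f : nat -> R) (mu : R) : Prop :=
  forall eps, 0 < eps -> exists c, forall k,
    Rabs (sumL k (fun t => f (w t)) - INR k * mu) <= eps * INR k + c.

(** The one-sided bound is applied to the centred function scaled into [[-1, 1]] and to its
    negative; [s] below is the sign. *)
Lemma slln L p f :
  (1 <= L)%nat -> (forall i, (i < L)%nat -> 0 < p i < 1) -> sumL L p = 1 ->
  almost_every L p (fun w => has_mean w f (sumL L (fun i => p i * f i))).
Proof.
  intros HL Hp Hsum. set (mu := sumL L (fun i => p i * f i)).
  destruct (finite_bound L (fun i => f i - mu)) as (H & H0 & HH).
  set (g := fun s i => s * / H * (f i - mu)).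
  assert (Hg : forall s, Rabs s = 1 -> almost_every L p (fun w => forall eps, 0 < eps ->
    exists c, forall k, sumL k (fun t => g s (w t)) <= eps * INR k + c)).
  { intros s Hs; apply slln_upper_normalized; auto.
    - intros i Hi; unfold g; rewrite !Rabs_mult, Hs, Rmult_1_l.
      rewrite (Rabs_right (/ H)) by (apply Rle_ge; left; now apply Rinv_0_lt_compat).
      apply Rmult_le_reg_l with H; [lra|]. rewrite <- Rmult_assoc, Rinv_r by lra.
      specialize (HH i Hi); simpl in HH; lra.
    - rewrite (sumL_ext _ _ (fun i => s * / H * (p i * f i) + - (s * / H * mu) * p i)).
      + rewrite sumL_plus, !sumL_scal, Hsum; fold mu; ring.
      + intros; unfold g; ring. }
  assert (H1 := Hg 1 Rabs_R1). assert (H2 := Hg (-1) ltac:(rewrite Rabs_left; lra)).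
  refine (almost_every_impl _ _ _ _ _ (almost_every_and _ _ _ _ H1 H2)).
  intros w Hw [W1 W2] eps Heps.
  assert (He : 0 < eps / H) by (apply Rdiv_lt_0_compat; lra).
  destruct (W1 _ He) as [c1 Hc1]; destruct (W2 _ He) as [c2 Hc2].
  exists (H * (Rabs c1 + Rabs c2)); intros k; specialize (Hc1 k); specialize (Hc2 k).
  assert (E : forall s, sumL k (fun t => g s (w t)) =
    s * / H * (sumL k (fun t => f (w t)) - INR k * mu)).
  { intros s; rewrite (sumL_ext _ _ (fun t => s * / H * f (w t) + - (s * / H * mu))).
    - rewrite sumL_plus, sumL_scal, sumL_const; ring.
    - intros; unfold g; ring. }
  rewrite E in Hc1, Hc2. set (X := sumL k (fun t => f (w t)) - INR k * mu) in *.
  assert (A1 := Rle_abs c1); assert (A2 := Rle_abs c2).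
  assert (A3 := Rabs_pos c1); assert (A4 := Rabs_pos c2).
  apply (Rmult_le_compat_l H) in Hc1; [|lra]; apply (Rmult_le_compat_l H) in Hc2; [|lra].
  replace (H * (1 * / H * X)) with X in Hc1 by (field; lra).
  replace (H * (-1 * / H * X)) with (- X) in Hc2 by (field; lra).
  replace (H * (eps / H * INR k + c1)) with (eps * INR k + H * c1) in Hc1 by (field; lra).
  replace (H * (eps / H * INR k + c2)) with (eps * INR k + H * c2) in Hc2 by (field; lra).
  apply Rabs_le; nra.
Qed.

(** * Levels and the growth rate *)

Lemma sumL_mono j k f : (forall t, 0 <= f t) -> (j <= k)%nat -> sumL j f <= sumL k f.
Proof.
  intros Hf; induction 1 as [|k Hk IH]; [lra|]. rewrite sumL_S; specialize (Hf k); lra.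
Qed.

(* [k] is the first scale at which the product of the contraction ratios,
   whose logarithms are [- g t], drops below [exp (- sigma)]. *)
Definition is_level (g : nat -> R) (sigma : R) (k : nat) : Prop :=
  sigma < sumL k g /\ forall j, (j < k)%nat -> sumL j g <= sigma.

Lemma level_exists g lo sigma :
  0 < lo -> (forall t, lo <= g t) -> exists k, is_level g sigma k.
Proof.
  intros Hlo Hg.
  destruct (INR_unbounded (sigma / lo)) as [K HK].
  assert (H : exists k, sigma < sumL k g).
  { exists K. apply Rlt_le_trans with (INR K * lo).
    - replace sigma with (sigma / lo * lo) by (field; lra). now apply Rmult_lt_compat_r.
    - rewrite <- sumL_const; apply sumL_le; auto. }
  destruct H as [k0 H]; revert H; induction k0 as [k IH] using lt_wf_ind; intros Hk.
  destruct (classic (exists j, (j < k)%nat /\ sigma < sumL j g)) as [(j & Hj & H)|H].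
  - eauto.
  - exists k; split; [exact Hk|]. intros j Hj; apply Rnot_lt_le; intros Hlt; eauto.
Qed.

Lemma level_upper g hi sigma k :
  0 <= sigma -> (forall t, g t <= hi) -> is_level g sigma k -> sumL k g <= sigma + hi.
Proof.
  intros Hs Hg [H1 H2]; destruct k as [|k]; [unfold sumL in H1; simpl in H1; lra|].
  specialize (H2 k (Nat.lt_succ_diag_r k)); rewrite sumL_S; specialize (Hg k); lra.
Qed.

Lemma level_le_sigma g s1 s2 k1 k2 :
  s1 <= s2 -> is_level g s1 k1 -> is_level g s2 k2 -> (k1 <= k2)%nat.
Proof.
  intros Hs [_ H1] [H2 _]; apply Nat.le_ngt; intros Hlt; specialize (H1 _ Hlt); lra.
Qed.

Lemma level_le_function g1 g2 s k1 k2 :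
  (forall t, g1 t <= g2 t) -> is_level g1 s k1 -> is_level g2 s k2 -> (k2 <= k1)%nat.
Proof.
  intros Hg [H1 _] [_ H2]; apply Nat.le_ngt; intros Hlt; specialize (H2 _ Hlt).
  assert (sumL k1 g1 <= sumL k1 g2) by (apply sumL_le; auto). lra.
Qed.

(** At such a [k] the sum of [g] is close both to [sigma] and to [k * mug], so [k] is close to
    [sigma / mug] and the sum of [f] to [muf / mug * sigma]. *)
Lemma sum_at_level w f g muf mug lo c eps :
  has_mean w f muf -> has_mean w g mug -> 0 < mug -> 0 < lo ->
  (forall t, lo <= g (w t)) -> 0 <= c -> 0 < eps ->
  exists C, forall sigma k, 0 <= sigma -> Rabs (sumL k (fun t => g (w t)) - sigma) <= c ->
    Rabs (sumL k (fun t => f (w t)) - muf / mug * sigma) <= eps * sigma + C.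
Proof.
  intros Hf Hg Hmu Hlo Hglo Hc Heps.
  set (q := Rabs (muf / mug)). assert (Hq : 0 <= q) by apply Rabs_pos.
  (* The total error is [(1 + q) e k] plus a constant, and [k * lo <= sigma + c]; this [e] bounds it
     by [eps * sigma] plus a constant. *)
  set (e := eps * lo / (1 + q)).
  assert (He : 0 < e) by (apply Rdiv_lt_0_compat; nra).
  destruct (Hf e He) as [c1 H1]; destruct (Hg e He) as [c2 H2].
  exists (eps * c + q * (c + c2) + c1); intros sigma k Hs Hk.
  specialize (H1 k); specialize (H2 k).
  assert (Hkl : INR k * lo <= sigma + c).
  { apply Rle_trans with (sumL k (fun t => g (w t))).
    - rewrite <- sumL_const; apply sumL_le; auto.
    - assert (Hr := Rle_abs (sumL k (fun t => g (w t)) - sigma)); lra. }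
  set (F := sumL k (fun t => f (w t))) in *. set (G := sumL k (fun t => g (w t))) in *.
  replace (F - muf / mug * sigma) with
    ((F - INR k * muf) + muf / mug * ((G - sigma) - (G - INR k * mug))) by (field; lra).
  eapply Rle_trans; [apply Rabs_triang|]. rewrite Rabs_mult; fold q.
  assert (H3 : Rabs ((G - sigma) - (G - INR k * mug)) <= c + (e * INR k + c2)).
  { eapply Rle_trans; [apply Rabs_triang|]. rewrite Rabs_Ropp; lra. }
  apply (Rmult_le_compat_l q) in H3; [|exact Hq].
  assert (E : (1 + q) * e = eps * lo) by (unfold e; field; lra).
  assert (eps * (INR k * lo) <= eps * (sigma + c)) by (apply Rmult_le_compat_l; lra).
  assert (E2 : (1 + q) * e * INR k = eps * lo * INR k) by (now rewrite E). lra.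
Qed.

Section Exponent.
Context (w : nat -> nat) (fm fn fN fB fC : nat -> R) (Sm Sn SN SB SC theta : R).

Definition log_count (h1 h2 l1 l2 : nat) : R :=
  let S f k := sumL k (fun t => f (w t)) in
  if (h1 <=? l2)%nat
  then S fC h1 - S fC h2 + (S fN l2 - S fN h1) + (S fB l1 - S fB l2)
  else S fC l2 - S fC h2 + (S fB l1 - S fB h1).

(** The value of [log_count] per unit of [s] after replacing [h1], [h2], [l1], [l2] by their
    asymptotic values [s / Sm], [s / Sn], [s / (theta Sm)], [s / (theta Sn)]. The test on [theta] is
    the order of [s / Sm] and [s / (theta Sn)]. *)
Definition log_rate : R :=
  if Rle_dec theta (Sm / Sn)
  then SC / Sm - SC / Sn + (SN / (theta * Sn) - SN / Sm) + (SB / (theta * Sm) - SB / (theta * Sn))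
  else SC / (theta * Sn) - SC / Sn + (SB / (theta * Sm) - SB / Sm).

(* When the order of [h1] and [l2] is not the one predicted by the sign of
   [theta - Sm / Sn], that order forces the two competing rates to agree up to
   a sublinear error. *)
Lemma log_count_asymptotic lo c eps :
  has_mean w fm Sm -> has_mean w fn Sn -> has_mean w fN SN -> has_mean w fB SB ->
  has_mean w fC SC -> 0 < Sm -> 0 < Sn -> 0 < theta -> 0 < lo ->
  (forall t, lo <= fm (w t)) -> (forall t, lo <= fn (w t)) -> 0 <= c -> 0 < eps ->
  exists K, forall s h1 h2 l1 l2, 0 <= s ->
    Rabs (sumL h1 (fun t => fm (w t)) - s) <= c ->
    Rabs (sumL h2 (fun t => fn (w t)) - s) <= c ->
    Rabs (sumL l1 (fun t => fm (w t)) - s / theta) <= c ->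
    Rabs (sumL l2 (fun t => fn (w t)) - s / theta) <= c ->
    Rabs (log_count h1 h2 l1 l2 - log_rate * s) <= eps * s + K.
Proof.
  intros Hm Hn HN HB HC HSm HSn Hth Hlo Hlm Hln Hc Heps.
  set (q := Rabs (SC + SB - SN) / Sm).
  assert (Hq : 0 <= q) by (apply Rmult_le_pos; [apply Rabs_pos|left; now apply Rinv_0_lt_compat]).
  (* At most six partial sums occur in [log_count], each with error [e s]; switching between the two
     rates costs a further [q e s]. Sums at scale [s / theta] are given the tolerance [e * theta],
     so that they too contribute [e s]. *)
  set (e := eps / (6 + q)).
  assert (He : 0 < e) by (apply Rdiv_lt_0_compat; lra).
  assert (Het : 0 < e * theta) by nra.
  destruct (sum_at_level w fC fm _ _ lo c e HC Hm HSm Hlo Hlm Hc He) as [K1 A1].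
  destruct (sum_at_level w fN fm _ _ lo c e HN Hm HSm Hlo Hlm Hc He) as [K2 A2].
  destruct (sum_at_level w fB fm _ _ lo c e HB Hm HSm Hlo Hlm Hc He) as [K3 A3].
  destruct (sum_at_level w fC fn _ _ lo c e HC Hn HSn Hlo Hln Hc He) as [K4 A4].
  destruct (sum_at_level w fC fn _ _ lo c _ HC Hn HSn Hlo Hln Hc Het) as [K5 A5].
  destruct (sum_at_level w fN fn _ _ lo c _ HN Hn HSn Hlo Hln Hc Het) as [K6 A6].
  destruct (sum_at_level w fB fn _ _ lo c _ HB Hn HSn Hlo Hln Hc Het) as [K7 A7].
  destruct (sum_at_level w fB fm _ _ lo c _ HB Hm HSm Hlo Hlm Hc Het) as [K8 A8].
  destruct (sum_at_level w fm fn _ _ lo c _ Hm Hn HSn Hlo Hln Hc Het) as [K9 A9].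
  set (M := Rabs K1 + Rabs K2 + Rabs K3 + Rabs K4 + Rabs K5 + Rabs K6 + Rabs K7 + Rabs K8).
  exists (M + q * (Rabs K9 + c)); intros s h1 h2 l1 l2 Hs B1 B2 B3 B4.
  assert (Hst : 0 <= s / theta) by (apply Rmult_le_pos; [lra|left; now apply Rinv_0_lt_compat]).
  specialize (A1 s h1 Hs B1). specialize (A2 s h1 Hs B1). specialize (A3 s h1 Hs B1).
  specialize (A4 s h2 Hs B2).
  specialize (A5 _ l2 Hst B4). specialize (A6 _ l2 Hst B4). specialize (A7 _ l2 Hst B4).
  specialize (A8 _ l1 Hst B3). specialize (A9 _ l2 Hst B4).
  replace (e * theta * (s / theta)) with (e * s) in * by (field; lra).
  assert (Hes : eps * s = (6 + q) * (e * s)) by (unfold e; field; lra).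
  assert (P0 : 0 <= e * s) by nra.
  assert (R1 := Rle_abs K1). assert (R2 := Rle_abs K2). assert (R3 := Rle_abs K3).
  assert (R4 := Rle_abs K4). assert (R5 := Rle_abs K5). assert (R6 := Rle_abs K6).
  assert (R7 := Rle_abs K7). assert (R8 := Rle_abs K8). assert (R9 := Rle_abs K9).
  assert (T1 := Rabs_pos K1). assert (T2 := Rabs_pos K2). assert (T3 := Rabs_pos K3).
  assert (T4 := Rabs_pos K4). assert (T5 := Rabs_pos K5). assert (T6 := Rabs_pos K6).
  assert (T7 := Rabs_pos K7). assert (T8 := Rabs_pos K8). assert (T9 := Rabs_pos K9).
  assert (Rabs_bounds : forall x y, Rabs x <= y -> - y <= x <= y).
  { intros x y; unfold Rabs; destruct Rcase_abs; lra. }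
  apply Rabs_bounds in A1, A2, A3, A4, A5, A6, A7, A8, A9, B1.
  rewrite Hes.
  set (V1 := SC / Sm * s - SC / Sn * s + (SN / Sn * (s / theta) - SN / Sm * s)
             + (SB / Sm * (s / theta) - SB / Sn * (s / theta))).
  set (V2 := SC / Sn * (s / theta) - SC / Sn * s + (SB / Sm * (s / theta) - SB / Sm * s)).
  (* Up to the error, [u] is the sum of [fm] over the first [l2] positions minus that over the first
     [h1]. It carries the sign of [Sm / Sn - theta] and measures the gap between the candidates [V1]
     and [V2]. *)
  set (u := Sm / Sn * (s / theta) - s) in *.
  assert (HV : V2 - V1 = (SC + SB - SN) / Sm * u) by (unfold V1, V2, u; field; lra).
  assert (HVu : forall y, Rabs u <= y -> Rabs (V2 - V1) <= q * y).
  { intros y Hy; rewrite HV, Rabs_mult. unfold Rdiv; rewrite Rabs_mult.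
    rewrite (Rabs_right (/ Sm)) by (apply Rle_ge; left; now apply Rinv_0_lt_compat).
    fold (Rabs (SC + SB - SN) / Sm); fold q. now apply Rmult_le_compat_l. }
  assert (Hmono : forall j k, (j <= k)%nat ->
    sumL j (fun t => fm (w t)) <= sumL k (fun t => fm (w t))).
  { intros j k; apply sumL_mono; intros t; specialize (Hlm t); lra. }
  assert (Hqc : 0 <= q * (e * s + Rabs K9 + c)) by (apply Rmult_le_pos; lra).
  assert (Hu : u = (Sm / Sn - theta) * (s / theta)) by (unfold u; field; lra).
  unfold log_count, log_rate.
  destruct (Nat.leb_spec h1 l2) as [Ho|Ho]; destruct (Rle_dec theta (Sm / Sn)) as [Ht|Ht].
  - match goal with |- context [?v * s] => replace (v * s) with V1 by (unfold V1; field; lra) end.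
    apply Rabs_le; unfold V1, M; lra.
  - match goal with |- context [?v * s] => replace (v * s) with V2 by (unfold V2; field; lra) end.
    (* The rate predicts [l2 < h1] but [h1 <= l2] holds: [u] is non-positive by [theta] and, by
       monotonicity of the sums, bounded below up to the error. The next case is the mirror
       image. *)
    assert (Hu0 : u <= 0) by (rewrite Hu; nra).
    specialize (Hmono h1 l2 Ho).
    specialize (HVu (e * s + Rabs K9 + c)). rewrite Rabs_left1 in HVu by lra.
    specialize (HVu ltac:(unfold u; lra)). apply Rabs_bounds in HVu.
    apply Rabs_le; unfold M; unfold V1 in HVu; lra.
  - match goal with |- context [?v * s] => replace (v * s) with V1 by (unfold V1; field; lra) end.
    assert (Hu0 : 0 <= u) by (rewrite Hu; nra).
    specialize (Hmono l2 h1 ltac:(lia)).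
    specialize (HVu (e * s + Rabs K9 + c)). rewrite Rabs_right in HVu by lra.
    specialize (HVu ltac:(unfold u; lra)). apply Rabs_bounds in HVu.
    apply Rabs_le; unfold M; unfold V2 in HVu; lra.
  - match goal with |- context [?v * s] => replace (v * s) with V2 by (unfold V2; field; lra) end.
    apply Rabs_le; unfold V2, M; lra.
Qed.

End Exponent.

(** * Distances and counting in lists *)

Lemma dist2_le_sum x y : dist2 x y <= Rabs (fst x - fst y) + Rabs (snd x - snd y).
Proof.
  unfold dist2. set (a := fst x - fst y); set (b := snd x - snd y).
  assert (Ha := Rabs_pos a); assert (Hb := Rabs_pos b).
  rewrite <- (sqrt_pow2 (Rabs a + Rabs b)) by lra.
  apply sqrt_le_1_alt. rewrite <- (pow2_abs a), <- (pow2_abs b). nra.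
Qed.

Lemma dist2_ge_fst x y : Rabs (fst x - fst y) <= dist2 x y.
Proof.
  unfold dist2. rewrite <- (sqrt_pow2 (Rabs _)) by apply Rabs_pos.
  apply sqrt_le_1_alt. rewrite pow2_abs. assert (H := pow2_ge_0 (snd x - snd y)). lra.
Qed.

Lemma dist2_ge_snd x y : Rabs (snd x - snd y) <= dist2 x y.
Proof.
  unfold dist2. rewrite <- (sqrt_pow2 (Rabs _)) by apply Rabs_pos.
  apply sqrt_le_1_alt. rewrite pow2_abs. assert (H := pow2_ge_0 (fst x - fst y)). lra.
Qed.

(** Pigeonhole principle for a relation: the partner chosen for the head is deleted from [l'], and
    by injectivity no other element can use it. *)
Lemma length_le_of_relation {X Y} (rel : X -> Y -> Prop) l l' :
  NoDup l -> (forall x, In x l -> exists y, In y l' /\ rel x y) ->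
  (forall x x' y, In x l -> In x' l -> rel x y -> rel x' y -> x = x') ->
  (length l <= length l')%nat.
Proof.
  intros Hl; revert l'; induction Hl as [|x l Hx Hl IH]; intros l' He Hu; simpl; [lia|].
  destruct (He x (or_introl eq_refl)) as (y & Hy & Hxy).
  apply in_split in Hy; destruct Hy as (l1 & l2 & ->).
  specialize (IH (l1 ++ l2)). rewrite length_app in *; simpl.
  assert (length l <= length l1 + length l2)%nat; [|lia]. apply IH.
  - intros x' Hx'; destruct (He x' (or_intror Hx')) as (y' & Hy' & Hr).
    exists y'; split; [|exact Hr]. apply in_app_iff in Hy'; apply in_app_iff.
    destruct Hy' as [|[<-|]]; auto.
    exfalso; apply Hx. rewrite (Hu x x' y); simpl; auto.
  - intros x1 x2 y' H1 H2; apply Hu; now right.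
Qed.

Lemma NoDup_flat_map {X Y} (f : X -> list Y) l :
  NoDup l -> (forall x, In x l -> NoDup (f x)) ->
  (forall x x' y, In x l -> In x' l -> In y (f x) -> In y (f x') -> x = x') ->
  NoDup (flat_map f l).
Proof.
  induction 1 as [|x l Hx Hl IH]; intros Hf Hd; simpl; [constructor|].
  apply NoDup_app.
  - apply Hf; now left.
  - apply IH; [intros; apply Hf; now right|]. intros x1 x2 y H1 H2; apply Hd; now right.
  - intros y Hy Hy'. apply in_flat_map in Hy'; destruct Hy' as (x' & Hx' & Hy').
    apply Hx; rewrite (Hd x x' y); simpl; auto.
Qed.

Lemma NoDup_map_injective {X Y} (f : X -> Y) l :
  NoDup l -> (forall x x', In x l -> In x' l -> f x = f x' -> x = x') -> NoDup (map f l).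
Proof.
  intros Hl Hf; induction Hl as [|x l Hx Hl IH]; simpl; constructor.
  - intros H; apply in_map_iff in H; destruct H as (x' & E & Hx').
    apply Hx; rewrite (Hf x x'); simpl; auto.
  - apply IH; intros x1 x2 H1 H2; apply Hf; now right.
Qed.

(** * Mixed radix addresses *)

Fixpoint addr (base a : nat -> nat) (k : nat) : nat :=
  match k with O => 0 | S k' => addr base a k' * base k' + a k' end%nat.

Fixpoint radix (base : nat -> nat) (k : nat) : nat :=
  match k with O => 1 | S k' => radix base k' * base k' end%nat.

(** The closed grid interval [[A / P, (A + 1) / P]], multiplied out to avoid division. *)
Definition in_cell (A P : nat) (x : R) : Prop := INR A <= x * INR P <= INR A + 1.

Lemma mixed_radix_injective b A A' d d' :
  (d < b)%nat -> (d' < b)%nat -> (A * b + d = A' * b + d')%nat -> A = A' /\ d = d'.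
Proof.
  intros Hd Hd' E.
  assert (A = A') by (destruct (Nat.lt_trichotomy A A') as [H|[H|H]]; [nia|assumption|nia]).
  subst; lia.
Qed.

Lemma addr_ext base a a' k :
  (forall t, (t < k)%nat -> a t = a' t) -> addr base a k = addr base a' k.
Proof.
  induction k as [|k IH]; intros H; simpl; [reflexivity|].
  rewrite IH, (H k); auto.
Qed.

Lemma addr_injective base a a' k :
  (forall t, (t < k)%nat -> (a t < base t)%nat) -> (forall t, (t < k)%nat -> (a' t < base t)%nat) ->
  addr base a k = addr base a' k -> forall t, (t < k)%nat -> a t = a' t.
Proof.
  induction k as [|k IH]; intros Ha Ha' E t Ht; [lia|]. simpl in E.
  apply mixed_radix_injective in E; auto. destruct E as [E Ek].
  destruct (Nat.eq_dec t k) as [->|]; [exact Ek|]. apply IH; auto; lia.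
Qed.

Lemma radix_pos base k : (forall t, (0 < base t)%nat) -> 0 < INR (radix base k).
Proof.
  intros H; apply lt_0_INR; induction k as [|k IH]; simpl; [lia|].
  specialize (H k); nia.
Qed.

Lemma radix_exp base k :
  (forall t, (t < k)%nat -> (0 < base t)%nat) ->
  INR (radix base k) = exp (sumL k (fun t => ln (INR (base t)))).
Proof.
  induction k as [|k IH]; intros H; [unfold sumL; simpl; now rewrite exp_0|].
  simpl radix. rewrite mult_INR, IH, sumL_S, exp_plus, exp_ln; auto.
  apply lt_0_INR; auto.
Qed.

Lemma in_cell_prefix base a j k x :
  (forall t, (t < k)%nat -> (a t < base t)%nat) -> (j <= k)%nat ->
  in_cell (addr base a k) (radix base k) x -> in_cell (addr base a j) (radix base j) x.
Proof.
  intros Ha Hjk; revert Ha; induction Hjk as [|k Hk IH]; intros Ha H; [exact H|].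
  apply IH; [auto|]. specialize (Ha k (Nat.lt_succ_diag_r k)).
  unfold in_cell in *; simpl in H. rewrite plus_INR, !mult_INR in H.
  assert (Hb : INR (a k) + 1 <= INR (base k)) by (rewrite <- S_INR; apply le_INR; lia).
  assert (H0 := pos_INR (a k)).
  split; apply Rmult_le_reg_r with (INR (base k)); nra.
Qed.

Lemma in_cell_close A A' P x x' c :
  in_cell A P x -> in_cell A' P x' -> Rabs (x - x') * INR P <= c ->
  Rabs (INR A - INR A') <= c + 1.
Proof.
  unfold in_cell; intros H H' Hc. assert (HP := pos_INR P).
  rewrite <- (Rabs_right (INR P)), <- Rabs_mult in Hc by lra.
  assert (Hx : - c <= (x - x') * INR P <= c) by (revert Hc; unfold Rabs; destruct Rcase_abs; lra).
  apply Rabs_le; lra.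
Qed.

Lemma in_cell_diam A P x x' d :
  0 < INR P -> 1 <= d * INR P -> in_cell A P x -> in_cell A P x' -> Rabs (x - x') <= d.
Proof.
  unfold in_cell; intros HP Hd H H'.
  apply Rabs_le; split; apply Rmult_le_reg_r with (INR P); nra.
Qed.

(** Nested intervals: [x] is the supremum of the left endpoints, and each right endpoint bounds all
    of them. *)
Lemma point_of_digits base a :
  (forall t, (a t < base t)%nat) -> exists x, forall k, in_cell (addr base a k) (radix base k) x.
Proof.
  intros Ha.
  assert (HP : forall k, 0 < INR (radix base k)).
  { intros k; apply radix_pos; intros t; specialize (Ha t); lia. }
  set (lower := fun k => INR (addr base a k) / INR (radix base k)).
  assert (Hlow : forall k, lower k * INR (radix base k) = INR (addr base a k)).
  { intros k; unfold lower; field; specialize (HP k); lra. }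
  assert (Hcell : forall j k, in_cell (addr base a (min j k)) (radix base (min j k)) (lower k)).
  { intros j k; apply (in_cell_prefix base a _ k); [auto|lia|]. unfold in_cell; rewrite Hlow; lra. }
  assert (Hupper : forall j k, lower k * INR (radix base j) <= INR (addr base a j) + 1).
  { intros j k; destruct (Nat.le_ge_cases j k) as [H|H].
    - specialize (Hcell j k); rewrite Nat.min_l in Hcell by lia; apply Hcell.
    - specialize (Hcell k j); rewrite Nat.min_l in Hcell by lia; destruct Hcell as [Hcell _].
      rewrite <- Hlow in Hcell; apply Rmult_le_reg_r in Hcell; [|apply HP].
      specialize (Hlow j); specialize (HP j); nra. }
  destruct (completeness (fun y => exists k, y = lower k)) as [x [Hub Hlub]].
  - exists 1; intros y [k ->]. specialize (Hupper 0%nat k); simpl in Hupper; lra.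
  - exists (lower 0%nat), 0%nat; reflexivity.
  - exists x; intros k; split.
    + rewrite <- Hlow; apply Rmult_le_compat_r; [left; apply HP|]. apply Hub; now exists k.
    + apply Rle_trans with ((INR (addr base a k) + 1) / INR (radix base k) * INR (radix base k)).
      * apply Rmult_le_compat_r; [left; apply HP|]. apply Hlub; intros y [j ->].
        apply Rmult_le_reg_r with (INR (radix base k)); [apply HP|].
        unfold Rdiv; rewrite Rmult_assoc, Rinv_l, Rmult_1_r by (specialize (HP k); lra). apply Hupper.
      * right; field; specialize (HP k); lra.
Qed.

(** * Digit sequences and points of the limit set *)

Section Limit_set.
Context (m n : nat -> nat) (D : nat -> nat -> nat -> bool) (w : nat -> nat).
Let mb t := m (w t).
Let nb t := n (w t).
Hypothesis mb_pos : forall t, (0 < mb t)%nat.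
Hypothesis nb_pos : forall t, (0 < nb t)%nat.

Definition admissible (t a b : nat) : Prop :=
  (a < m (w t))%nat /\ (b < n (w t))%nat /\ D (w t) a b = true.

(** [iter_map] recurses on the outermost map, while [addr] appends the last digit; this splits off
    the innermost map instead. *)
Lemma iter_map_snoc a b t r z :
  iter_map m n w a b t (S r) z =
  iter_map m n w a b t r (Smap m n (w (t + r)%nat) (a (t + r)%nat) (b (t + r)%nat) z).
Proof.
  revert t; induction r as [|r IH]; intros t; [simpl; now rewrite Nat.add_0_r|].
  change (iter_map m n w a b t (S (S r)) z) with
    (Smap m n (w t) (a t) (b t) (iter_map m n w a b (S t) (S r) z)).
  rewrite IH; simpl; now rewrite Nat.add_succ_r.
Qed.

Lemma iter_map_addr a b k z :
  iter_map m n w a b 0 k z =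
  ((INR (addr mb a k) + fst z) / INR (radix mb k), (INR (addr nb b k) + snd z) / INR (radix nb k)).
Proof.
  revert z; induction k as [|k IH]; intros z.
  - simpl; destruct z; simpl; f_equal; field.
  - rewrite iter_map_snoc, IH; simpl. rewrite !plus_INR, !mult_INR. unfold mb, nb in *.
    assert (H1 := lt_0_INR _ (mb_pos k)); assert (H2 := lt_0_INR _ (nb_pos k)).
    assert (H3 := radix_pos _ k mb_pos); assert (H4 := radix_pos _ k nb_pos).
    unfold mb, nb in *.
    f_equal; field; split; lra.
Qed.

(** The digits may depend on [k], so no compactness argument is involved: one finite word provides
    the cells of all depths up to [k] as its prefixes. *)
Lemma Fomega_cells x k : (1 <= k)%nat -> Fomega m n D w x ->
  exists a b, (forall t, (t < k)%nat -> admissible t (a t) (b t)) /\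
    (forall j, (j <= k)%nat -> in_cell (addr mb a j) (radix mb j) (fst x) /\
                              in_cell (addr nb b j) (radix nb j) (snd x)).
Proof.
  intros Hk Hx; destruct (Hx k Hk) as (a & b & Hab & z & [Hz1 Hz2] & ->).
  exists a, b; split; [exact Hab|]. intros j Hj.
  assert (H3 := radix_pos mb k mb_pos); assert (H4 := radix_pos nb k nb_pos).
  rewrite iter_map_addr; simpl; split; apply (in_cell_prefix _ _ _ k); auto;
    try (intros t Ht; apply (Hab t Ht)); unfold in_cell, Rdiv;
    rewrite Rmult_assoc, Rinv_l by lra; lra.
Qed.

Lemma Fomega_of_digits a b : (forall t, admissible t (a t) (b t)) ->
  exists x, Fomega m n D w x /\
    forall k, in_cell (addr mb a k) (radix mb k) (fst x) /\ in_cell (addr nb b k) (radix nb k) (snd x).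
Proof.
  intros Hab.
  destruct (point_of_digits mb a) as [x1 H1]; [intros t; apply Hab|].
  destruct (point_of_digits nb b) as [x2 H2]; [intros t; apply Hab|].
  exists (x1, x2); split; [|intros k; split; [apply H1|apply H2]].
  intros k _; exists a, b; split; [intros t _; apply Hab|].
  exists (x1 * INR (radix mb k) - INR (addr mb a k), x2 * INR (radix nb k) - INR (addr nb b k)).
  split.
  - specialize (H1 k); specialize (H2 k); unfold in_cell in *; split; simpl; lra.
  - rewrite iter_map_addr; simpl.
    assert (H3 := radix_pos mb k mb_pos); assert (H4 := radix_pos nb k nb_pos).
    f_equal; field; lra.
Qed.

End Limit_set.

Section Codes.
Context (mb nb : nat -> nat) (opt : nat -> list (nat * nat)) (l : nat).

(* Codes of length [k] record the [x]-address of depth [k] and the [y]-address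
   of depth [min k l] of the digit sequences drawn from [opt]. *)
Fixpoint codes (k : nat) : list (nat * nat) :=
  match k with
  | O => [(0, 0)]
  | S k' => flat_map (fun c => map (fun d =>
      (fst c * mb k' + fst d, if k' <? l then snd c * nb k' + snd d else snd c)) (opt k')) (codes k')
  end%nat.

Lemma length_codes k : length (codes k) = radix (fun t => length (opt t)) k.
Proof.
  induction k as [|k IH]; simpl; [reflexivity|]. rewrite <- IH; clear IH.
  generalize (opt k) as ds; intros ds.
  induction (codes k) as [|c cs IHc]; simpl; [reflexivity|].
  rewrite length_app, length_map, IHc; reflexivity.
Qed.

Lemma addr_min_S b k :
  addr nb b (Nat.min (S k) l) =
  (if k <? l then addr nb b (Nat.min k l) * nb k + b k else addr nb b (Nat.min k l))%nat.
Proof.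
  destruct (Nat.ltb_spec k l).
  - rewrite !Nat.min_l by lia; reflexivity.
  - rewrite !Nat.min_r by lia; reflexivity.
Qed.

Lemma in_codes a b k :
  (forall t, (t < k)%nat -> In (a t, b t) (opt t)) ->
  In (addr mb a k, addr nb b (Nat.min k l)) (codes k).
Proof.
  induction k as [|k IH]; intros H; [now left|]. rewrite addr_min_S; simpl.
  apply in_flat_map; eexists; split; [apply IH; auto|].
  apply in_map_iff; exists (a k, b k); split; [|apply H; lia]. simpl. reflexivity.
Qed.

Lemma codes_digits k c : In c (codes k) -> exists a b,
  (forall t, (t < k)%nat -> In (a t, b t) (opt t)) /\
  c = (addr mb a k, addr nb b (Nat.min k l)).
Proof.
  revert c; induction k as [|k IH]; intros c Hc.
  - destruct Hc as [<-|[]]. exists (fun _ => 0%nat), (fun _ => 0%nat); split; [intros; lia|reflexivity].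
  - simpl in Hc; apply in_flat_map in Hc; destruct Hc as (c' & Hc' & Hc).
    apply in_map_iff in Hc; destruct Hc as ([d1 d2] & <- & Hd).
    destruct (IH c' Hc') as (a & b & Hab & ->).
    set (upd := fun (f : nat -> nat) d t => if Nat.eq_dec t k then d else f t).
    assert (Hk : forall f d, upd f d k = d) by (intros; unfold upd; destruct Nat.eq_dec; congruence).
    assert (Hlt : forall f d t, (t < k)%nat -> upd f d t = f t)
      by (intros; unfold upd; destruct Nat.eq_dec; [lia|reflexivity]).
    exists (upd a d1), (upd b d2); split.
    + intros t Ht; destruct (Nat.eq_dec t k) as [->|]; [now rewrite !Hk|].
      rewrite !Hlt by lia; apply Hab; lia.
    + rewrite addr_min_S; simpl; rewrite !Hk.
      rewrite (addr_ext mb (upd a d1) a) by (intros; apply Hlt; lia).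
      rewrite (addr_ext nb (upd b d2) b) by (intros; apply Hlt; lia).
      reflexivity.
Qed.

(** Each step of the construction can be undone: below [l] both digits are read off as remainders,
    and from [l] on the recorded column digit determines the option. *)
Lemma NoDup_codes k :
  (forall t d, In d (opt t) -> (fst d < mb t)%nat /\ (snd d < nb t)%nat) ->
  (forall t, NoDup (opt t)) ->
  (forall t d d', (l <= t)%nat -> In d (opt t) -> In d' (opt t) -> fst d = fst d' -> d = d') ->
  NoDup (codes k).
Proof.
  intros Hr Hnd Hl; induction k as [|k IH]; [constructor; [simpl; tauto|constructor]|].
  assert (Hinj : forall c c' d d', In d (opt k) -> In d' (opt k) ->
    (fst c * mb k + fst d, if k <? l then snd c * nb k + snd d else snd c)%nat =
    (fst c' * mb k + fst d', if k <? l then snd c' * nb k + snd d' else snd c')%nat ->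
    c = c' /\ d = d').
  { intros [c1 c2] [c1' c2'] d d' Hd Hd' E; simpl in E; injection E as E1 E2.
    destruct (Hr _ _ Hd) as [R1 R2]; destruct (Hr _ _ Hd') as [R1' R2'].
    apply mixed_radix_injective in E1; auto; destruct E1 as [-> E1].
    destruct (Nat.ltb_spec k l) as [Hk|Hk].
    - apply mixed_radix_injective in E2; auto; destruct E2 as [-> E2].
      destruct d, d'; simpl in *; subst; auto.
    - subst; split; [reflexivity|]. now apply (Hl k). }
  simpl; apply NoDup_flat_map; [exact IH| |].
  - intros c _; apply NoDup_map_injective; [apply Hnd|].
    intros d d' Hd Hd' E; now apply (Hinj c c) in E.
  - intros c c' y _ _ H H'; apply in_map_iff in H, H'.
    destruct H as (d & <- & Hd); destruct H' as (d' & E & Hd').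
    symmetry; now apply (Hinj c' c d' d).
Qed.

End Codes.

(** * Counting approximate squares *)

Lemma fold_max_ge l x : In x l -> (x <= fold_right Nat.max 0 l)%nat.
Proof.
  induction l as [|y l IH]; simpl; [tauto|]. intros [->|H]; [lia|]. specialize (IH H); lia.
Qed.

Lemma fold_max_in l : l <> [] -> In (fold_right Nat.max 0%nat l) l.
Proof.
  induction l as [|y l IH]; [congruence|]; intros _; simpl.
  destruct l as [|z l]; [left; simpl; lia|].
  destruct (Nat.max_spec y (fold_right Nat.max 0%nat (z :: l))) as [[_ ->]|[_ ->]]; [|now left].
  right; apply IH; congruence.
Qed.

Section Squares.
Context (n : nat -> nat) (D : nat -> nat -> nat -> bool).

Definition column (i a : nat) : list nat := filter (D i a) (List.seq 0 (n i)).
Definition row_in (i a : nat) : nat := hd 0%nat (column i a).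

Lemma in_column i a b : In b (column i a) <-> (b < n i)%nat /\ D i a b = true.
Proof. unfold column; rewrite filter_In, in_seq; intuition lia. Qed.

Lemma row_in_column i a : (0 < colcount n D i a)%nat -> In (row_in i a) (column i a).
Proof.
  unfold row_in; change (colcount n D i a) with (length (column i a)).
  destruct (column i a); simpl; [lia|auto].
Qed.

Lemma NoDup_column i a : NoDup (column i a).
Proof. apply NoDup_filter, seq_NoDup. Qed.

Lemma colcount_pos i a b : (b < n i)%nat -> D i a b = true -> (0 < colcount n D i a)%nat.
Proof.
  intros Hb HD; assert (H : In b (column i a)) by (now apply in_column).
  change (colcount n D i a) with (length (column i a)).
  destruct (column i a); simpl in *; [tauto|lia].
Qed.

Context (m : nat -> nat).

Definition columns (i : nat) : list nat :=
  filter (fun a => Nat.ltb 0 (colcount n D i a)) (List.seq 0 (m i)).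
Definition rectangles (i : nat) : list (nat * nat) :=
  flat_map (fun a => map (pair a) (column i a)) (List.seq 0 (m i)).
(** A column attaining [C_i]. The point using it at every position is the centre at which the
    largest count is reached. *)
Definition max_column (i : nat) : nat :=
  hd 0%nat (filter (fun a => colcount n D i a =? Ccount m n D i)%nat (List.seq 0 (m i))).

Lemma in_columns i a : In a (columns i) <-> (a < m i)%nat /\ (0 < colcount n D i a)%nat.
Proof. unfold columns; rewrite filter_In, in_seq, Nat.ltb_lt; intuition lia. Qed.

Lemma in_rectangles i d :
  In d (rectangles i) <-> (fst d < m i)%nat /\ In (snd d) (column i (fst d)).
Proof.
  unfold rectangles; rewrite in_flat_map; destruct d as [a b]; simpl; split.
  - intros (a' & Ha & H); apply in_map_iff in H; destruct H as (b' & E & Hb).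
    injection E as -> ->. apply in_seq in Ha; split; [lia|exact Hb].
  - intros [Ha Hb]; exists a; rewrite in_seq, in_map_iff; split; [lia|eauto].
Qed.

Lemma length_rectangles i : length (rectangles i) = Ncount m n D i.
Proof.
  unfold rectangles, Ncount. induction (List.seq 0 (m i)) as [|a s IH]; simpl; [reflexivity|].
  now rewrite length_app, length_map, IH.
Qed.

Lemma colcount_le_Ccount i a : (a < m i)%nat -> (colcount n D i a <= Ccount m n D i)%nat.
Proof.
  intros Ha; apply fold_max_ge; apply (in_map (colcount n D i)); apply in_seq; lia.
Qed.

Lemma max_column_spec i : (0 < m i)%nat ->
  (max_column i < m i)%nat /\ colcount n D i (max_column i) = Ccount m n D i.
Proof.
  intros Hm. unfold max_column.
  set (s := filter _ _).
  assert (Hs : forall a, In a s -> (a < m i)%nat /\ colcount n D i a = Ccount m n D i).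
  { intros a Ha; apply filter_In in Ha; destruct Ha as [Ha E].
    apply in_seq in Ha; apply Nat.eqb_eq in E; split; [lia|exact E]. }
  apply Hs. destruct s as [|a s'] eqn:E; [|now left]. exfalso.
  assert (H : In (Ccount m n D i) (map (colcount n D i) (List.seq 0 (m i)))).
  { apply fold_max_in; destruct (m i); [lia|discriminate]. }
  apply in_map_iff in H; destruct H as (a & Ha & Hin).
  assert (Hin' : In a s) by (apply filter_In; split; [exact Hin|now apply Nat.eqb_eq]).
  rewrite E in Hin'; exact Hin'.
Qed.

(** * Approximate squares of the fine level inside one of the coarse level *)

Section Levels.
Context (w : nat -> nat) (h1 h2 l1 l2 : nat).
Hypothesis h2_le_h1 : (h2 <= h1)%nat.
Hypothesis h1_le_l1 : (h1 <= l1)%nat.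
Hypothesis h2_le_l2 : (h2 <= l2)%nat.
Hypothesis l2_le_l1 : (l2 <= l1)%nat.
Hypothesis mn_pos : forall t, (0 < m (w t))%nat /\ (0 < n (w t))%nat.
Hypothesis w_nonempty : forall t, exists a b, admissible m n D w t a b.

Notation mb := (fun t => m (w t)).
Notation nb := (fun t => n (w t)).
Notation lnN := (fun i => ln (INR (Ncount m n D i))).
Notation lnB := (fun i => ln (INR (Bcount m n D i))).
Notation lnC := (fun i => ln (INR (Ccount m n D i))).

(* Digits of the approximate squares of level [(l1, l2)] contained in the
   approximate square of level [(h1, h2)] with digits [a0, b0]; at positions
   where only the column matters, [row_in] picks one rectangle in it. *)
Definition options (a0 b0 : nat -> nat) (t : nat) : list (nat * nat) :=
  let i := w t in
  if (t <? h2)%nat then [(a0 t, b0 t)]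
  else if (t <? h1)%nat then
    if (t <? l2)%nat then map (pair (a0 t)) (column i (a0 t)) else [(a0 t, row_in i (a0 t))]
  else if (t <? l2)%nat then rectangles i
  else map (fun a => (a, row_in i a)) (columns i).

Lemma options_admissible a0 b0 t d :
  admissible m n D w t (a0 t) (b0 t) -> In d (options a0 b0 t) ->
  admissible m n D w t (fst d) (snd d).
Proof.
  intros (Ha & Hb & HD); unfold options.
  assert (Hcol := colcount_pos _ _ _ Hb HD).
  destruct (t <? h2)%nat; [intros [<-|[]]; now repeat split|].
  destruct (t <? h1)%nat; destruct (t <? l2)%nat; intros H.
  - apply in_map_iff in H; destruct H as (b & <- & H); apply in_column in H.
    now repeat split.
  - destruct H as [<-|[]]. apply row_in_column, in_column in Hcol; now repeat split.
  - apply in_rectangles in H; destruct H as [H1 H2]; apply in_column in H2; now repeat split.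
  - apply in_map_iff in H; destruct H as (a & <- & H); apply in_columns in H.
    destruct H as [H1 H2]; apply row_in_column, in_column in H2; now repeat split.
Qed.

Lemma options_fst a0 b0 t d : (t < h1)%nat -> In d (options a0 b0 t) -> fst d = a0 t.
Proof.
  intros Ht; unfold options; apply Nat.ltb_lt in Ht; rewrite Ht.
  destruct (t <? h2)%nat; [intros [<-|[]]; reflexivity|].
  destruct (t <? l2)%nat; [|intros [<-|[]]; reflexivity].
  intros H; apply in_map_iff in H; now destruct H as (b & <- & _).
Qed.

Lemma options_snd a0 b0 t d : (t < h2)%nat -> In d (options a0 b0 t) -> snd d = b0 t.
Proof.
  intros Ht; unfold options; apply Nat.ltb_lt in Ht; rewrite Ht.
  intros [<-|[]]; reflexivity.
Qed.

Lemma options_row a0 b0 t d d' : (l2 <= t)%nat ->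
  In d (options a0 b0 t) -> In d' (options a0 b0 t) -> fst d = fst d' -> d = d'.
Proof.
  intros Ht; unfold options.
  replace (t <? h2)%nat with false by (symmetry; apply Nat.ltb_ge; lia).
  replace (t <? l2)%nat with false by (symmetry; apply Nat.ltb_ge; lia).
  destruct (t <? h1)%nat; [intros [<-|[]] [<-|[]]; reflexivity|].
  intros H H'; apply in_map_iff in H, H'.
  destruct H as (a & <- & _); destruct H' as (a' & <- & _); simpl; now intros ->.
Qed.

Lemma NoDup_options a0 b0 t : NoDup (options a0 b0 t).
Proof.
  assert (H1 : forall d : nat * nat, NoDup [d]) by (intros; constructor; [simpl; tauto|constructor]).
  assert (H2 : forall a, NoDup (map (pair a) (column (w t) a))).
  { intros a; apply NoDup_map_injective; [apply NoDup_column|congruence]. }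
  unfold options; destruct (t <? h2)%nat; [apply H1|].
  destruct (t <? h1)%nat; destruct (t <? l2)%nat; [apply H2|apply H1| |].
  - apply NoDup_flat_map; [apply seq_NoDup|intros; apply H2|].
    intros a a' d _ _ H H'; apply in_map_iff in H, H'.
    destruct H as (b & <- & _); destruct H' as (b' & E & _); congruence.
  - apply NoDup_map_injective; [apply NoDup_filter, seq_NoDup|congruence].
Qed.

(** From [l2] on the row is no longer recorded, so an arbitrary admissible digit may be replaced by
    the representative row of its column. *)
Lemma in_options a0 b0 a b t :
  admissible m n D w t a b -> ((t < h1)%nat -> a = a0 t) -> ((t < h2)%nat -> b = b0 t) ->
  In (a, if (t <? l2)%nat then b else row_in (w t) a) (options a0 b0 t).
Proof.
  intros (Ha & Hb & HD) Ea Eb; unfold options.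
  assert (Hcol := colcount_pos _ _ _ Hb HD).
  assert (Hin : In b (column (w t) a)) by (now apply in_column).
  destruct (Nat.ltb_spec t h2) as [H|H].
  - rewrite Ea, Eb by lia. replace (t <? l2)%nat with true by (symmetry; apply Nat.ltb_lt; lia).
    now left.
  - destruct (Nat.ltb_spec t h1) as [H'|H']; [rewrite <- Ea by exact H'|]; destruct (t <? l2)%nat.
    + now apply in_map.
    + now left.
    + apply in_rectangles; now split.
    + apply (in_map (fun a => (a, row_in (w t) a))), in_columns; now split.
Qed.

(** Writes the differences of partial sums as one sum over positions, whose cases match those of
    [options]. *)
Lemma log_count_sum fN fB fC :
  log_count w fN fB fC h1 h2 l1 l2 = sumL l1 (fun t =>
    if (t <? h2)%nat then 0
    else if (t <? h1)%nat then if (t <? l2)%nat then fC (w t) else 0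
    else if (t <? l2)%nat then fN (w t) else fB (w t)).
Proof.
  set (g := fun t => _).
  (* Over a run of positions where [g] agrees with [f], both partial sums grow by the same amount;
     the two orders of [h1] and [l2] are then treated run by run. *)
  assert (Hpiece : forall (f : nat -> R) j k, (j <= k)%nat ->
    (forall t, (j <= t < k)%nat -> g t = f t) -> sumL k g = sumL j g + (sumL k f - sumL j f)).
  { intros f j k; induction 1 as [|k Hk IH]; intros E; [lra|].
    rewrite !sumL_S, IH, E by (try intros; try apply E; lia); lra. }
  assert (Hg : forall t, g t =
    if (t <? h2)%nat then 0
    else if (t <? h1)%nat then if (t <? l2)%nat then fC (w t) else 0
    else if (t <? l2)%nat then fN (w t) else fB (w t)) by reflexivity.
  assert (H0 : sumL h2 g = 0).
  { rewrite (Hpiece (fun _ => 0) 0%nat h2) by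
      (try lia; intros t Ht; rewrite Hg; destruct (Nat.ltb_spec t h2); lia || reflexivity).
    rewrite !sumL_const; unfold sumL; simpl; ring. }
  unfold log_count; destruct (Nat.leb_spec h1 l2) as [Ho|Ho].
  - rewrite (Hpiece (fun t => fB (w t)) l2 l1), (Hpiece (fun t => fN (w t)) h1 l2),
      (Hpiece (fun t => fC (w t)) h2 h1); try lia; try lra;
      intros t Ht; rewrite Hg; destruct (Nat.ltb_spec t h2); try lia;
      destruct (Nat.ltb_spec t h1); try lia; destruct (Nat.ltb_spec t l2); try lia; reflexivity.
  - rewrite (Hpiece (fun t => fB (w t)) h1 l1), (Hpiece (fun t => 0) l2 h1),
      (Hpiece (fun t => fC (w t)) h2 l2); rewrite ?sumL_const; try lia; try lra;
      intros t Ht; rewrite Hg; destruct (Nat.ltb_spec t h2); try lia;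
      destruct (Nat.ltb_spec t h1); try lia; destruct (Nat.ltb_spec t l2); try lia; reflexivity.
Qed.

Lemma length_options_pos a0 b0 t :
  admissible m n D w t (a0 t) (b0 t) -> (0 < length (options a0 b0 t))%nat.
Proof.
  intros H; assert (Hin := in_options a0 b0 _ _ t H (fun _ => eq_refl) (fun _ => eq_refl)).
  destruct (options a0 b0 t); simpl in *; [tauto|lia].
Qed.

Lemma ln_length_options a0 b0 t :
  ln (INR (length (options a0 b0 t))) =
    if (t <? h2)%nat then 0
    else if (t <? h1)%nat then
      if (t <? l2)%nat then ln (INR (colcount n D (w t) (a0 t))) else 0
    else if (t <? l2)%nat then lnN (w t) else lnB (w t).
Proof.
  unfold options; destruct (t <? h2)%nat; [simpl; apply ln_1|].
  destruct (t <? h1)%nat; destruct (t <? l2)%nat.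
  - rewrite length_map; reflexivity.
  - simpl; apply ln_1.
  - now rewrite length_rectangles.
  - rewrite length_map; reflexivity.
Qed.

Lemma length_codes_exp a0 b0 :
  (forall t, (t < l1)%nat -> admissible m n D w t (a0 t) (b0 t)) ->
  INR (length (codes mb nb (options a0 b0) l2 l1)) =
  exp (sumL l1 (fun t => ln (INR (length (options a0 b0 t))))).
Proof.
  intros H; rewrite length_codes, radix_exp; [reflexivity|].
  intros t Ht; now apply length_options_pos, H.
Qed.

Lemma codes_upper a0 b0 :
  (forall t, (t < l1)%nat -> admissible m n D w t (a0 t) (b0 t)) ->
  INR (length (codes mb nb (options a0 b0) l2 l1)) <= exp (log_count w lnN lnB lnC h1 h2 l1 l2).
Proof.
  intros H; rewrite length_codes_exp by exact H. apply exp_le_exp. rewrite log_count_sum.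
  apply sumL_le; intros t Ht; rewrite ln_length_options.
  destruct (t <? h2)%nat; [lra|]. destruct (t <? h1)%nat; destruct (t <? l2)%nat; try lra.
  destruct (H t Ht) as (Ha & Hb & HD).
  apply ln_le_ln; [apply lt_0_INR; now apply (colcount_pos _ _ (b0 t))|].
  now apply le_INR, colcount_le_Ccount.
Qed.

(** The targets are addresses of coarse squares. A target realised by some digits [a0], [b0]
    contributes the codes of [options a0 b0]; a target realised by none contributes nothing. *)
Lemma squares_upper (targets : list (nat * nat)) :
  exists T, INR (length T) <= INR (length targets) * exp (log_count w lnN lnB lnC h1 h2 l1 l2) /\
    forall a b, (forall t, (t < l1)%nat -> admissible m n D w t (a t) (b t)) ->
      In (addr mb a h1, addr nb b h2) targets -> In (addr mb a l1, addr nb b l2) T.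
Proof.
  induction targets as [|[A B] targets (T & HT & IH)].
  - exists []; split; [simpl; lra|]; intros a b _ [].
  - destruct (classic (exists a0 b0, (forall t, (t < l1)%nat -> admissible m n D w t (a0 t) (b0 t)) /\
      addr mb a0 h1 = A /\ addr nb b0 h2 = B)) as [(a0 & b0 & H0 & EA & EB)|Hno].
    + exists (codes mb nb (options a0 b0) l2 l1 ++ T); split.
      { rewrite length_app, plus_INR; assert (Hu := codes_upper a0 b0 H0).
        change (length ((A, B) :: targets)) with (S (length targets)); rewrite S_INR; lra. }
      intros a b Hab [E|Hin]; apply in_app_iff; [left|right; now apply IH].
      rewrite <- EA, <- EB in E; injection E as E1 E2.
      assert (Ea : forall t, (t < h1)%nat -> a t = a0 t).
      { symmetry in E1; apply (addr_injective mb); try assumption; intros t Ht;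
          [apply (Hab t)|apply (H0 t)]; lia. }
      assert (Eb : forall t, (t < h2)%nat -> b t = b0 t).
      { symmetry in E2; apply (addr_injective nb); try assumption; intros t Ht;
          [apply (Hab t)|apply (H0 t)]; lia. }
      (* The change of rows from [l2] on leaves the address of depth [l2] intact. *)
      set (b' := fun t => if (t <? l2)%nat then b t else row_in (w t) (a t)).
      replace (addr nb b l2) with (addr nb b' (Nat.min l1 l2)).
      * apply in_codes; intros t Ht; apply in_options; auto.
      * rewrite Nat.min_r by lia; apply addr_ext; intros t Ht; unfold b'.
        apply Nat.ltb_lt in Ht; now rewrite Ht.
    + exists T; split.
      { assert (0 < exp (log_count w lnN lnB lnC h1 h2 l1 l2)) by apply exp_pos.
        change (length ((A, B) :: targets)) with (S (length targets)); rewrite S_INR; lra. }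
      intros a b Hab [E|Hin]; [|now apply IH]. exfalso; apply Hno; exists a, b.
      now injection E as -> ->.
Qed.

(** Points within [R] of [x] have coarse addresses differing from those of [x] by less than [q] in
    each coordinate, which leaves at most [(2q + 1)^2] coarse squares. Fine squares have sides at
    most [r / 2], hence diameter at most [r]. *)
Lemma cover_upper q R r x :
  Fomega m n D w x ->
  R * INR (radix mb h1) + 1 < INR q -> R * INR (radix nb h2) + 1 < INR q ->
  2 <= r * INR (radix mb l1) -> 2 <= r * INR (radix nb l2) ->
  cover_le (fun y => Fomega m n D w y /\ dist2 x y <= R) r
    (INR ((2 * q + 1) * (2 * q + 1)) * exp (log_count w lnN lnB lnC h1 h2 l1 l2)).
Proof.
  intros Hx Hq1 Hq2 Hr1 Hr2.
  assert (Hm : forall t, (0 < mb t)%nat) by (intros t; apply mn_pos).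
  assert (Hn : forall t, (0 < nb t)%nat) by (intros t; apply mn_pos).
  (* Depth [S l1] is positive, as [Fomega_cells] demands, and exceeds all four levels. *)
  destruct (Fomega_cells m n D w Hm Hn x (S l1) ltac:(lia) Hx) as (ax & bx & _ & Hcx).
  set (Ax := addr mb ax h1) in *. set (Bx := addr nb bx h2) in *.
  (* Truncated subtraction may repeat the address 0, which is harmless for an upper bound. *)
  set (around := fun A => map (fun i => (A + i - q)%nat) (List.seq 0 (2 * q + 1))).
  assert (Haround : forall A A', Rabs (INR A - INR A') < INR q -> In A' (around A)).
  { intros A A' H. assert (Hb : - INR q < INR A - INR A' < INR q)
      by (revert H; unfold Rabs; destruct Rcase_abs; lra).
    assert (H1 : (A < A' + q)%nat) by (apply INR_lt; rewrite plus_INR; lra).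
    assert (H2 : (A' < A + q)%nat) by (apply INR_lt; rewrite plus_INR; lra).
    apply in_map_iff; exists (A' + q - A)%nat; split; [lia|]. apply in_seq; lia. }
  destruct (squares_upper (list_prod (around Ax) (around Bx))) as (T & HT & Hin).
  exists (length T), (fun j y => let c := nth j T (0, 0)%nat in
    in_cell (fst c) (radix mb l1) (fst y) /\ in_cell (snd c) (radix nb l2) (snd y)).
  split; [|split].
  - rewrite length_prod in HT. unfold around in HT; rewrite !length_map, !length_seq in HT. exact HT.
  - intros j _ y z [Hy1 Hy2] [Hz1 Hz2]. eapply Rle_trans; [apply dist2_le_sum|].
    assert (Rabs (fst y - fst z) <= r / 2).
    { apply (in_cell_diam _ _ _ _ _ (radix_pos mb l1 Hm)) with (2 := Hy1); [lra|exact Hz1]. }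
    assert (Rabs (snd y - snd z) <= r / 2).
    { apply (in_cell_diam _ _ _ _ _ (radix_pos nb l2 Hn)) with (2 := Hy2); [lra|exact Hz2]. }
    lra.
  - intros y [Hy Hd].
    destruct (Fomega_cells m n D w Hm Hn y (S l1) ltac:(lia) Hy) as (a & b & Hab & Hcy).
    assert (HinT : In (addr mb a l1, addr nb b l2) T).
    { apply Hin; [intros t Ht; apply Hab; lia|]. apply in_prod; apply Haround.
      - apply Rle_lt_trans with (2 := Hq1).
        apply (in_cell_close _ _ (radix mb h1) (fst x) (fst y)); [apply Hcx; lia|apply Hcy; lia|].
        apply Rmult_le_compat_r; [apply pos_INR|]. eapply Rle_trans; [apply dist2_ge_fst|exact Hd].
      - apply Rle_lt_trans with (2 := Hq2).
        apply (in_cell_close _ _ (radix nb h2) (snd x) (snd y)); [apply Hcx; lia|apply Hcy; lia|].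
        apply Rmult_le_compat_r; [apply pos_INR|]. eapply Rle_trans; [apply dist2_ge_snd|exact Hd]. }
    apply (In_nth _ _ (0, 0)%nat) in HinT; destruct HinT as (j & Hj & Ej).
    exists j; split; [exact Hj|]. cbv zeta; rewrite Ej; simpl.
    split; [apply (Hcy l1)|apply (Hcy l2)]; lia.
Qed.

(** Around the point with digits [max_column] the number of codes is exactly [exp (log_count ...)].
    Each code is realised by a point within [R], and a single set of diameter at most [r] serves at
    most [q * q] codes. *)
Lemma cover_lower q R r :
  2 <= R * INR (radix mb h1) -> 2 <= R * INR (radix nb h2) ->
  r * INR (radix mb l1) + 1 < INR q -> r * INR (radix nb l2) + 1 < INR q ->
  exists x, Fomega m n D w x /\ forall X,
    cover_le (fun y => Fomega m n D w y /\ dist2 x y <= R) r X ->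
    exp (log_count w lnN lnB lnC h1 h2 l1 l2) <= INR (q * q) * X.
Proof.
  intros HR1 HR2 Hq1 Hq2.
  assert (Hm : forall t, (0 < mb t)%nat) by (intros t; apply mn_pos).
  assert (Hn : forall t, (0 < nb t)%nat) by (intros t; apply mn_pos).
  set (a0 := fun t => max_column (w t)). set (b0 := fun t => row_in (w t) (a0 t)).
  assert (Hmax : forall t, (a0 t < m (w t))%nat /\
    colcount n D (w t) (a0 t) = Ccount m n D (w t)) by (intros; apply max_column_spec, Hm).
  assert (H0 : forall t, admissible m n D w t (a0 t) (b0 t)).
  { intros t; destruct (Hmax t) as [Ha HC]. destruct (w_nonempty t) as (a & b & H1 & H2 & H3).
    assert (Hc : (0 < colcount n D (w t) (a0 t))%nat).
    { apply (colcount_pos _ a b H2) in H3. rewrite HC.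
      eapply Nat.lt_le_trans; [exact H3|now apply colcount_le_Ccount]. }
    apply row_in_column, in_column in Hc; now repeat split. }
  set (cs := codes mb nb (options a0 b0) l2 l1).
  assert (Hlen : INR (length cs) = exp (log_count w lnN lnB lnC h1 h2 l1 l2)).
  { unfold cs; rewrite length_codes_exp by auto. f_equal. rewrite log_count_sum.
    apply sumL_ext; intros t _; rewrite ln_length_options. now rewrite (proj2 (Hmax t)). }
  assert (HND : NoDup cs).
  { apply NoDup_codes.
    - intros t d Hd; apply options_admissible in Hd; [|apply H0].
      destruct Hd as (Ha & Hb & _); now split.
    - intros t; apply NoDup_options.
    - intros t d d'; apply options_row. }
  destruct (Fomega_of_digits m n D w Hm Hn a0 b0 H0) as (x & Hx & Hcx).
  assert (Hpt : forall c, In c cs -> exists y, Fomega m n D w y /\ dist2 x y <= R /\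
    in_cell (fst c) (radix mb l1) (fst y) /\ in_cell (snd c) (radix nb l2) (snd y)).
  { intros c Hc; apply codes_digits in Hc; destruct Hc as (a & b & Hab & ->); simpl.
    rewrite Nat.min_r by lia.
    (* The digits of the code are continued by those of [x] to an infinite admissible sequence. *)
    set (a' := fun t => if (t <? l1)%nat then a t else a0 t).
    set (b' := fun t => if (t <? l1)%nat then b t else b0 t).
    assert (Ea : forall t, (t < l1)%nat -> a' t = a t)
      by (intros t Ht; unfold a'; apply Nat.ltb_lt in Ht; now rewrite Ht).
    assert (Eb : forall t, (t < l1)%nat -> b' t = b t)
      by (intros t Ht; unfold b'; apply Nat.ltb_lt in Ht; now rewrite Ht).
    assert (H' : forall t, admissible m n D w t (a' t) (b' t)).
    { intros t; unfold a', b'; destruct (Nat.ltb_spec t l1) as [Ht|Ht]; [|apply H0].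
      apply (options_admissible _ _ _ _ (H0 t) (Hab t Ht)). }
    destruct (Fomega_of_digits m n D w Hm Hn a' b' H') as (y & Hy & Hcy).
    exists y; split; [exact Hy|]; split.
    - eapply Rle_trans; [apply dist2_le_sum|].
      assert (Rabs (fst x - fst y) <= R / 2).
      { destruct (Hcx h1) as [C1 _]; destruct (Hcy h1) as [C2 _].
        rewrite (addr_ext mb a' a0) in C2.
        - apply (in_cell_diam _ _ _ _ _ (radix_pos mb h1 Hm)) with (2 := C1); [lra|exact C2].
        - intros t Ht; rewrite Ea by lia.
          apply (options_fst a0 b0 t (a t, b t) Ht), Hab; lia. }
      assert (Rabs (snd x - snd y) <= R / 2).
      { destruct (Hcx h2) as [_ C1]; destruct (Hcy h2) as [_ C2].
        rewrite (addr_ext nb b' b0) in C2.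
        - apply (in_cell_diam _ _ _ _ _ (radix_pos nb h2 Hn)) with (2 := C1); [lra|exact C2].
        - intros t Ht; rewrite Eb by lia.
          apply (options_snd a0 b0 t (a t, b t) Ht), Hab; lia. }
      lra.
    - rewrite <- (addr_ext mb a' a) by (intros; apply Ea; lia).
      rewrite <- (addr_ext nb b' b) by (intros; apply Eb; lia).
      split; [apply (Hcy l1)|apply (Hcy l2)]. }
  exists x; split; [exact Hx|]. intros X (k & U & HkX & Hdiam & Hcov).
  (* If [q] were 0, then [r] would be negative, but some covering set contains a point and so has
     non-negative diameter. *)
  assert (Hq0 : (q <> 0)%nat).
  { intros ->; simpl in Hq1.
    assert (HP := radix_pos mb l1 Hm). assert (HQ := radix_pos nb l2 Hn).
    destruct (Hpt (addr mb a0 l1, addr nb b0 l2)) as (y & Hy & Hd & _).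
    - replace (addr nb b0 l2) with (addr nb b0 (Nat.min l1 l2)) by (rewrite Nat.min_r by lia; reflexivity).
      apply in_codes; intros t _.
      assert (Hin := in_options a0 b0 _ _ t (H0 t) (fun _ => eq_refl) (fun _ => eq_refl)).
      unfold b0 in *; now destruct (t <? l2)%nat.
    - destruct (Hcov y (conj Hy Hd)) as (j & Hj & HU). assert (Hd' := Hdiam j Hj y y HU HU).
      assert (0 <= dist2 y y) by apply sqrt_pos. nra. }
  (* A set of diameter at most [r] meets two cells only if their addresses
     differ by less than [q], so residues modulo [q] tell them apart. *)
  assert (Hmod : forall A A', (A mod q = A' mod q)%nat -> Rabs (INR A - INR A') < INR q -> A = A').
  { intros A A' E H. assert (Hb : - INR q < INR A - INR A' < INR q)
      by (revert H; unfold Rabs; destruct Rcase_abs; lra).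
    assert (H1 : (A < A' + q)%nat) by (apply INR_lt; rewrite plus_INR; lra).
    assert (H2 : (A' < A + q)%nat) by (apply INR_lt; rewrite plus_INR; lra).
    assert (E1 := Nat.div_mod A q Hq0). assert (E2 := Nat.div_mod A' q Hq0).
    destruct (Nat.lt_trichotomy (A / q) (A' / q)) as [Hl|[He|Hl]]; nia. }
  assert (Hle : (length cs <= k * (q * q))%nat).
  { rewrite <- (length_seq k 0), <- (length_seq q 0), <- !length_prod.
    (* A code is related to the index of a covering set that meets its cell, together with the
       residues of its two addresses. *)
    apply (length_le_of_relation (fun c v => exists y, U (fst v) y /\ (fst v < k)%nat /\
      in_cell (fst c) (radix mb l1) (fst y) /\ in_cell (snd c) (radix nb l2) (snd y) /\
      snd v = (fst c mod q, snd c mod q)%nat)); [exact HND| |].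
    - intros c Hc; destruct (Hpt c Hc) as (y & Hy & Hd & Hc1 & Hc2).
      destruct (Hcov y (conj Hy Hd)) as (j & Hj & HU).
      exists (j, (fst c mod q, snd c mod q))%nat; split.
      + repeat apply in_prod; apply in_seq; [lia| |]; split; try lia; now apply Nat.mod_upper_bound.
      + exists y; simpl; repeat (split; [assumption|]); reflexivity.
    - intros [A B] [A' B'] [j v] _ _; simpl.
      intros (y & HU & Hj & C1 & C2 & ->) (y' & HU' & _ & C1' & C2' & E); simpl in *.
      injection E as E1 E2. assert (Hd := Hdiam j Hj y y' HU HU').
      f_equal; apply Hmod; try assumption.
      + apply Rle_lt_trans with (2 := Hq1).
        apply (in_cell_close _ _ _ _ _ _ C1 C1').
        apply Rmult_le_compat_r; [apply pos_INR|]. eapply Rle_trans; [apply dist2_ge_fst|exact Hd].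
      + apply Rle_lt_trans with (2 := Hq2).
        apply (in_cell_close _ _ _ _ _ _ C2 C2').
        apply Rmult_le_compat_r; [apply pos_INR|]. eapply Rle_trans; [apply dist2_ge_snd|exact Hd]. }
  rewrite <- Hlen. apply le_INR in Hle; rewrite mult_INR in Hle.
  assert (Hqq := pos_INR (q * q)). nra.
Qed.

End Levels.
End Squares.

(** * The Assouad spectrum *)

Lemma ln_INR_ge_ln2 k : (2 <= k)%nat -> ln 2 <= ln (INR k).
Proof. intros H; apply ln_le_ln; [lra|]. now apply (le_INR 2). Qed.

(** The shift by [ln 2] makes the cell side at most half the scale, so that two sides together fit
    into it; the overshoot of the last step is at most [hi], which gives the other bound. *)
Lemma level_radix base sigma h hi :
  (forall t, (0 < base t)%nat) -> (forall t, ln (INR (base t)) <= hi) -> 0 <= sigma -> 0 <= hi ->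
  is_level (fun t => ln (INR (base t))) (sigma + ln 2) h ->
  Rabs (sumL h (fun t => ln (INR (base t))) - sigma) <= ln 2 + hi /\
  2 <= exp (- sigma) * INR (radix base h) <= 2 * exp hi.
Proof.
  intros Hb Hhi Hs Hhi0 Hl. assert (H2 := ln_lt_2).
  assert (Hu := level_upper _ hi (sigma + ln 2) h ltac:(lra) Hhi Hl). destruct Hl as [Hl _].
  split; [apply Rabs_le; lra|].
  rewrite radix_exp, <- exp_plus by auto.
  split.
  - apply Rle_trans with (exp (ln 2)); [rewrite exp_ln; lra|apply exp_le_exp; lra].
  - replace (2 * exp hi) with (exp (ln 2 + hi)) by (rewrite exp_plus, exp_ln; lra).
    apply exp_le_exp; lra.
Qed.

Section Spectrum.
Context (m n : nat -> nat) (D : nat -> nat -> nat -> bool) (w : nat -> nat) (theta hi : R).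
Hypothesis mn_ge2 : forall t, (2 <= m (w t))%nat /\ (m (w t) <= n (w t))%nat.
Hypothesis w_nonempty : forall t, exists a b, admissible m n D w t a b.
Hypothesis theta_range : 0 < theta < 1.
Hypothesis hi_bound : forall t, ln (INR (n (w t))) <= hi.

Notation mb := (fun t => m (w t)).
Notation nb := (fun t => n (w t)).
Notation lnm := (fun i => ln (INR (m i))).
Notation lnn := (fun i => ln (INR (n i))).
Notation lnN := (fun i => ln (INR (Ncount m n D i))).
Notation lnB := (fun i => ln (INR (Bcount m n D i))).
Notation lnC := (fun i => ln (INR (Ccount m n D i))).

(** Both covering estimates hold with the same four levels, and one [q] serves every scale because
    [level_radix] bounds all the rescaled products by [2 * exp hi]. *)
Lemma covering_bounds q s : 2 * exp hi + 1 < INR q -> 0 <= s ->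
  exists h1 h2 l1 l2,
    let E := exp (log_count w lnN lnB lnC h1 h2 l1 l2) in
    Rabs (sumL h1 (fun t => lnm (w t)) - s) <= ln 2 + hi /\
    Rabs (sumL h2 (fun t => lnn (w t)) - s) <= ln 2 + hi /\
    Rabs (sumL l1 (fun t => lnm (w t)) - s / theta) <= ln 2 + hi /\
    Rabs (sumL l2 (fun t => lnn (w t)) - s / theta) <= ln 2 + hi /\
    (forall x, Fomega m n D w x ->
      cover_le (fun y => Fomega m n D w y /\ dist2 x y <= exp (- s)) (exp (- (s / theta)))
        (INR ((2 * q + 1) * (2 * q + 1)) * E)) /\
    (exists x, Fomega m n D w x /\ forall X,
      cover_le (fun y => Fomega m n D w y /\ dist2 x y <= exp (- s)) (exp (- (s / theta))) X ->
      E <= INR (q * q) * X).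
Proof.
  intros Hq Hs.
  assert (Hln2 := ln_lt_2).
  assert (Hst : s <= s / theta).
  { apply Rmult_le_reg_r with theta; [lra|].
    unfold Rdiv; rewrite Rmult_assoc, Rinv_l by lra. nra. }
  assert (Hpos : forall t, (0 < m (w t))%nat /\ (0 < n (w t))%nat)
    by (intros t; specialize (mn_ge2 t); lia).
  assert (Hlm : forall t, ln 2 <= lnm (w t)) by (intros t; apply ln_INR_ge_ln2, mn_ge2).
  assert (Hmn : forall t, lnm (w t) <= lnn (w t)).
  { intros t; apply ln_le_ln; [apply lt_0_INR, Hpos|apply le_INR, mn_ge2]. }
  assert (Hln : forall t, ln 2 <= lnn (w t)) by (intros t; specialize (Hlm t); specialize (Hmn t); lra).
  assert (Hhi : 0 <= hi) by (specialize (Hln 0%nat); specialize (hi_bound 0%nat); simpl in *; lra).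
  destruct (level_exists (fun t => lnm (w t)) (ln 2) (s + ln 2) ltac:(lra) Hlm) as [h1 L1].
  destruct (level_exists (fun t => lnn (w t)) (ln 2) (s + ln 2) ltac:(lra) Hln) as [h2 L2].
  destruct (level_exists (fun t => lnm (w t)) (ln 2) (s / theta + ln 2) ltac:(lra) Hlm) as [l1 L3].
  destruct (level_exists (fun t => lnn (w t)) (ln 2) (s / theta + ln 2) ltac:(lra) Hln) as [l2 L4].
  (* The order of the levels comes from [m <= n] and from [s <= s / theta]. *)
  assert (O1 := level_le_function _ _ _ _ _ Hmn L1 L2).
  assert (O2 := level_le_function _ _ _ _ _ Hmn L3 L4).
  assert (O3 := level_le_sigma _ _ _ _ _ (Rplus_le_compat_r (ln 2) _ _ Hst) L1 L3).
  assert (O4 := level_le_sigma _ _ _ _ _ (Rplus_le_compat_r (ln 2) _ _ Hst) L2 L4).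
  assert (Hm_hi : forall t, lnm (w t) <= hi) by (intros t; eapply Rle_trans; [apply Hmn|apply hi_bound]).
  apply (level_radix mb _ _ hi) in L1, L3; try (intros t; apply Hpos); auto; try lra.
  apply (level_radix nb _ _ hi) in L2, L4; try (intros t; apply Hpos); auto; try lra.
  destruct L1 as [A1 B1]; destruct L2 as [A2 B2]; destruct L3 as [A3 B3]; destruct L4 as [A4 B4].
  exists h1, h2, l1, l2; cbv zeta; repeat (split; [assumption|]); split.
  - intros x Hx; apply cover_upper; auto; lra.
  - apply cover_lower; auto; lra.
Qed.

(** With [R = exp (- s)] the ratio [R / R^(1/theta)] is [exp (k s)] for [k = 1/theta - 1], so an
    exponential growth rate [V] in [s] is an exponent [V / k]. *)
Lemma assouad_spectrum_of_means Sm Sn SN SB SC :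
  has_mean w lnm Sm -> has_mean w lnn Sn -> has_mean w lnN SN -> has_mean w lnB SB ->
  has_mean w lnC SC -> 0 < Sm -> 0 < Sn ->
  assouad_spectrum_eq (Fomega m n D w) theta
    (log_rate Sm Sn SN SB SC theta / (1 / theta - 1)).
Proof.
  intros Hm Hn HN HB HC HSm HSn.
  set (V := log_rate Sm Sn SN SB SC theta). set (k := 1 / theta - 1).
  assert (Hk : 0 < k).
  { unfold k. apply Rmult_lt_reg_r with theta; [lra|].
    rewrite Rmult_minus_distr_r; unfold Rdiv; rewrite Rmult_assoc, Rinv_l by lra; lra. }
  set (v := V / k). assert (HV : V = k * v) by (unfold v; field; lra).
  assert (Hln2 := ln_lt_2).
  assert (Hlm : forall t, ln 2 <= lnm (w t)) by (intros t; apply ln_INR_ge_ln2, mn_ge2).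
  assert (Hln : forall t, ln 2 <= lnn (w t))
    by (intros t; apply ln_INR_ge_ln2; specialize (mn_ge2 t); lia).
  assert (Hhi : 0 <= hi) by (specialize (Hln 0%nat); specialize (hi_bound 0%nat); simpl in *; lra).
  assert (Hc2 : 0 < ln 2) by lra. assert (Hch : 0 <= ln 2 + hi) by lra.
  assert (Has := fun eps => log_count_asymptotic w lnm lnn lnN lnB lnC Sm Sn SN SB SC theta
    (ln 2) (ln 2 + hi) eps Hm Hn HN HB HC HSm HSn (proj1 theta_range) Hc2 Hlm Hln Hch).
  destruct (INR_unbounded (2 * exp hi + 1)) as [q Hq].
  assert (Hscale : forall s alpha, Rpower (exp (- s)) (1 / theta) = exp (- (s / theta)) /\
    Rpower (exp (- s) / exp (- (s / theta))) alpha = exp (alpha * k * s)).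
  { intros s alpha. unfold Rpower, Rdiv. rewrite <- exp_Ropp, <- exp_plus, !ln_exp.
    split; f_equal; unfold k; field; lra. }
  assert (HRabs : forall x y, Rabs x <= y -> - y <= x <= y)
    by (intros x y; unfold Rabs; destruct Rcase_abs; lra).
  assert (Hqpos : 0 < INR q) by (assert (H := exp_pos hi); lra).
  split.
  - intros alpha (C & HCpos & Hcov). apply Rnot_lt_le; intros Hlt.
    set (g := k * (v - alpha)). assert (Hg : 0 < g) by (apply Rmult_lt_0_compat; lra).
    destruct (Has (g / 2) ltac:(lra)) as [K HK].
    set (A := ln (INR (q * q) * C)).
    (* For [alpha < v] the two bounds on [log_count] would give [g * s / 2 <= A + K], which fails at
       this [s]. *)
    set (s := 2 * (Rabs A + Rabs K + 1) / g).
    assert (HA := Rle_abs A); assert (HK' := Rle_abs K).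
    assert (HA0 := Rabs_pos A); assert (HK0 := Rabs_pos K).
    assert (Hs : 0 < s) by (apply Rdiv_lt_0_compat; lra).
    assert (Hsg : g * s = 2 * (Rabs A + Rabs K + 1)) by (unfold s; field; lra).
    destruct (covering_bounds q s Hq ltac:(lra)) as (h1 & h2 & l1 & l2 & B1 & B2 & B3 & B4 & _ & x & Hx & Hlow).
    specialize (HK s h1 h2 l1 l2 ltac:(lra) B1 B2 B3 B4). apply HRabs in HK.
    assert (HR : 0 < exp (- s) < 1).
    { split; [apply exp_pos|]. rewrite <- exp_0; apply exp_increasing; lra. }
    specialize (Hcov _ HR x Hx). destruct (Hscale s alpha) as [E1 E2].
    rewrite E1, E2 in Hcov. apply Hlow in Hcov.
    assert (Hqq : 0 < INR (q * q) * C) by (rewrite mult_INR; repeat apply Rmult_lt_0_compat; lra).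
    rewrite <- Rmult_assoc, <- (exp_ln (INR (q * q) * C)), <- exp_plus in Hcov by exact Hqq.
    assert (Hexp : log_count w lnN lnB lnC h1 h2 l1 l2 <= A + alpha * k * s).
    { apply Rnot_lt_le; intros Hc; apply exp_increasing in Hc; unfold A in Hc; lra. }
    fold V in HK; rewrite HV in HK. unfold g in Hsg, HK. nra.
  - intros v' Hv'. apply le_epsilon; intros delta Hdelta. apply Hv'.
    (* Each [v + delta] is an admissible exponent: the error [k * delta * s] is exactly what the
       extra [delta] provides. *)
    destruct (Has (k * delta) ltac:(nra)) as [K HK].
    set (Q := INR ((2 * q + 1) * (2 * q + 1))).
    assert (HQ : 0 < Q) by (apply lt_0_INR; nia).
    exists (Q * exp K); split; [apply Rmult_lt_0_compat; [exact HQ|apply exp_pos]|].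
    intros Rr HR x Hx. set (s := - ln Rr).
    assert (Hs : 0 < s).
    { assert (H : ln Rr < ln 1) by (apply ln_increasing; lra). rewrite ln_1 in H; unfold s; lra. }
    assert (ER : Rr = exp (- s)) by (unfold s; rewrite Ropp_involutive, exp_ln; lra).
    rewrite ER. destruct (Hscale s (v + delta)) as [E1 E2]. rewrite E1, E2.
    destruct (covering_bounds q s Hq ltac:(lra)) as (h1 & h2 & l1 & l2 & B1 & B2 & B3 & B4 & Hup & _).
    specialize (HK s h1 h2 l1 l2 ltac:(lra) B1 B2 B3 B4). apply HRabs in HK.
    destruct (Hup x Hx) as (N & U & HN1 & HU). exists N, U; split; [|exact HU].
    eapply Rle_trans; [exact HN1|]. fold Q. rewrite Rmult_assoc, <- exp_plus.
    apply Rmult_le_compat_l; [lra|]. apply exp_le_exp. fold V in HK; rewrite HV in HK. lra.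
Qed.

End Spectrum.

(** * From the growth rate to the closed formula *)

Theorem theorem3p1 (L : nat) (m n : nat -> nat) (D : nat -> nat -> nat -> bool)
  (p : nat -> R)
  (HL : (1 <= L)%nat)
  (Hmn : forall i, (i < L)%nat -> (2 <= m i)%nat /\ (m i < n i)%nat)
  (HD : forall i, (i < L)%nat ->
          exists a b, (a < m i)%nat /\ (b < n i)%nat /\ D i a b = true)
  (Hp : forall i, (i < L)%nat -> 0 < p i < 1)
  (Hsum : sumL L p = 1) :
  let N i := INR (Ncount m n D i) in
  let B i := INR (Bcount m n D i) in
  let C i := INR (Ccount m n D i) in
  let Sm := sumL L (fun i => p i * ln (INR (m i))) in
  let Sn := sumL L (fun i => p i * ln (INR (n i))) in
  almost_every L p (fun w =>
    forall theta, 0 < theta < 1 ->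
      assouad_spectrum_eq (Fomega m n D w) theta
        (if Rle_dec theta (Sm / Sn) then
           1 / (1 - theta) *
             (sumL L (fun i => p i * ln (B i * Rpower (C i) theta * Rpower (N i) (- theta))) / Sm
              + sumL L (fun i => p i * ln (N i * / B i * Rpower (C i) (- theta))) / Sn)
         else
           sumL L (fun i => p i * ln (B i)) / Sm + sumL L (fun i => p i * ln (C i)) / Sn)).
Proof.
  intros N B C Sm Sn.
  set (SN := sumL L (fun i => p i * ln (N i))).
  set (SB := sumL L (fun i => p i * ln (B i))).
  set (SC := sumL L (fun i => p i * ln (C i))).
  assert (Hslln := fun f => slln L p f HL Hp Hsum).
  (* The five means are secured before [theta] is introduced, so a single null set serves all
     [theta]. *)
  refine (almost_every_impl _ _ _ _ _
    (almost_every_and _ _ _ _ (Hslln (fun i => ln (INR (m i))))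
    (almost_every_and _ _ _ _ (Hslln (fun i => ln (INR (n i))))
    (almost_every_and _ _ _ _ (Hslln (fun i => ln (N i)))
    (almost_every_and _ _ _ _ (Hslln (fun i => ln (B i))) (Hslln (fun i => ln (C i)))))))).
  intros w Hw (Wm & Wn & WN & WB & WC) theta Hth.
  assert (Hln2 := ln_lt_2).
  assert (Hpos : forall f, (forall i, (i < L)%nat -> ln 2 <= f i) -> 0 < sumL L (fun i => p i * f i)).
  { intros f Hf; apply Rlt_le_trans with (sumL L (fun i => ln 2 * p i)).
    - rewrite sumL_scal, Hsum; lra.
    - apply sumL_le; intros i Hi; specialize (Hf i Hi); specialize (Hp i Hi); nra. }
  assert (HSm : 0 < Sm) by (apply Hpos; intros i Hi; apply ln_INR_ge_ln2, Hmn, Hi).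
  assert (HSn : 0 < Sn)
    by (apply Hpos; intros i Hi; apply ln_INR_ge_ln2; specialize (Hmn i Hi); lia).
  destruct (finite_bound L (fun i => ln (INR (n i)))) as (hi & _ & Hhi).
  assert (Hspec := assouad_spectrum_of_means m n D w theta hi
    (fun t => conj (proj1 (Hmn _ (Hw t))) (Nat.lt_le_incl _ _ (proj2 (Hmn _ (Hw t)))))
    (fun t => HD _ (Hw t)) Hth (fun t => Rle_trans _ _ _ (Rle_abs _) (Hhi _ (Hw t)))
    Sm Sn SN SB SC Wm Wn WN WB WC HSm HSn).
  match type of Hspec with assouad_spectrum_eq _ _ ?u =>
    match goal with |- assouad_spectrum_eq _ _ ?v => replace v with u; [exact Hspec|] end end.
  assert (HNB : forall i, (i < L)%nat -> 0 < N i /\ 0 < B i).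
  { intros i Hi; destruct (HD i Hi) as (a & b & Ha & Hb & Hab).
    assert (Hc := colcount_pos n D i a b Hb Hab).
    assert (Hr : In b (column n D i a)) by (now apply in_column).
    split; apply lt_0_INR.
    - rewrite <- length_rectangles.
      assert (H : In (a, b) (rectangles n D m i)) by (now apply in_rectangles).
      destruct (rectangles n D m i); simpl in *; [tauto|lia].
    - change (0 < length (columns n D m i))%nat.
      assert (H : In a (columns n D m i)) by (now apply in_columns).
      destruct (columns n D m i); simpl in *; [tauto|lia]. }
  (* Expanding the logarithms makes both sides rational expressions in [theta] and the five means,
     which [field] then identifies. *)
  assert (E1 : sumL L (fun i => p i * ln (B i * Rpower (C i) theta * Rpower (N i) (- theta))) =
    SB + theta * SC + - theta * SN).
  { unfold SB, SC, SN; rewrite <- !sumL_scal, <- !sumL_plus; apply sumL_ext; intros i Hi.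
    destruct (HNB i Hi) as [HNi HBi]. unfold Rpower.
    assert (H1 := exp_pos (theta * ln (C i))).
    rewrite !ln_mult, !ln_exp; try apply exp_pos; try apply Rmult_lt_0_compat; auto; ring. }
  assert (E2 : sumL L (fun i => p i * ln (N i * / B i * Rpower (C i) (- theta))) =
    SN + -1 * SB + - theta * SC).
  { unfold SB, SC, SN; rewrite <- !sumL_scal, <- !sumL_plus; apply sumL_ext; intros i Hi.
    destruct (HNB i Hi) as [HNi HBi]. unfold Rpower.
    assert (H1 := Rinv_0_lt_compat _ HBi).
    rewrite !ln_mult, !ln_exp, ln_Rinv; try apply exp_pos; try apply Rmult_lt_0_compat; auto; ring. }
  rewrite E1, E2; unfold log_rate.
  destruct (Rle_dec theta (Sm / Sn)); field; repeat split; try lra.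
Qed.
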